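(* Let $n\geq 2$, let $\Omega\subset\mathbb{R}^n$ be a domain with finite Lebesgue measure, let $\delta\in(0,1)$ and $\tau\in(0,\infty)$ be fixed, and let $1\leq p\leq q<\infty$. Then the following statements are equivalent: (i) $\Omega$ satisfies the fractional $(q,p)$-Sobolev-Poincaré inequality, i.e. there is a constant $C$ such that for every $u\in C(\Omega)$ $$\int_\Omega|u(x)-u_\Omega|^q\,dx\leq C\Big(\int_\Omega\int_{\Omega\cap B(x,\tau d(x,\partial\Omega))}\frac{|u(x)-u(y)|^p}{|x-y|^{n+p\delta}}\,dy\,dx\Big)^{q/p}.$$ (ii) For an arbitrary ball $B_0\subset\Omega$ there exists a constant $C=C(\Omega,p,q,B_0)$ such that $$|A|^{p/q}\leq C\inf\int_\Omega g_u(x)\,dx$$ for every measurable set $A\subset\Omega$ with $A\cap B_0=\emptyset$, where the infimum is taken over all functions $u\in C(\Omega)$ that satisfy $u|_A\geq 1$ and $u|_{B_0}=0$.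
   Context: $C(\Omega)$ is the set of continuous real-valued functions on $\Omega$; $|A|$ is the Lebesgue measure of $A$; $u_\Omega=\frac{1}{|\Omega|}\int_\Omega u(x)\,dx$; $d(x,\partial\Omega)$ is the Euclidean distance from $x$ to the boundary of $\Omega$; $B(x,r)$ is the Euclidean ball with centre $x$ and radius $r$. For $u\in C(\Omega)$ the function $g_u$ is defined for $x\in\Omega$ by $$g_u(x)=\int_{\Omega\cap B(x,\tau d(x,\partial\Omega))}\frac{|u(x)-u(y)|^p}{|x-y|^{n+p\delta}}\,dy.$$ The numbers $\delta\in(0,1)$ and $\tau\in(0,\infty)$ are fixed throughout (constants may depend on them). *)

(* Defs.v *)
From HB Require Import structures.
From mathcomp Require Import all_boot all_order all_algebra.
From mathcomp Require Import all_classical all_reals all_analysis.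

Set Implicit Arguments.
Unset Strict Implicit.
Unset Printing Implicit Defensive.

Import Order.TTheory GRing.Theory Num.Theory.
Import numFieldNormedType.Exports.

Local Open Scope classical_set_scope.
Local Open Scope ring_scope.

(* R^n is ['rV[R]_n].  Its library topology is the usual one, but its library
   norm [`|x|] is the sup norm, and [ball] is a cube: hence [enorm], [eball]. *)

Section lebesgue.
Context {R : realType} {n : nat}.
Implicit Types (A : set 'rV[R]_n) (ab : 'rV[R]_n * 'rV[R]_n)
  (P : set ('rV[R]_n * 'rV[R]_n)).

Definition box ab : set 'rV[R]_n :=
  [set x | forall i, ab.1 0 i <= x 0 i <= ab.2 0 i].

Definition box_volume ab : R := \prod_(i < n) (ab.2 0 i - ab.1 0 i).

Definition box_cover A P : Prop :=
  [/\ countable P,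
      (forall ab, P ab -> forall i, ab.1 0 i <= ab.2 0 i) &
      A `<=` \bigcup_(ab in P) box ab].

Local Open Scope ereal_scope.

Definition lebesgue_outer A : \bar R :=
  ereal_inf [set \esum_(ab in P) (box_volume ab)%:E | P in box_cover A].

Let volume_ge0 A P ab : box_cover A P -> P ab -> 0 <= (box_volume ab)%:E.
Proof.
by move=> [_ le_ab _] Pab; rewrite lee_fin prodr_ge0// => i _;
  rewrite subr_ge0 le_ab.
Qed.

Let cover_ge0 A P : box_cover A P -> 0 <= \esum_(ab in P) (box_volume ab)%:E.
Proof. by move=> AP; apply: esum_ge0 => ab; exact: volume_ge0 AP. Qed.

Lemma lebesgue_outer_ge0 A : 0 <= lebesgue_outer A.
Proof. by apply: le_ereal_inf_tmp => _ [P AP <-]; exact: cover_ge0 AP. Qed.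

Lemma lebesgue_outer0 : lebesgue_outer set0 = 0.
Proof.
apply/eqP; rewrite eq_le lebesgue_outer_ge0 andbT.
by apply: ereal_inf_lbound; exists set0; [split|rewrite esum_set0].
Qed.

Lemma le_lebesgue_outer : {homo lebesgue_outer : A B / A `<=` B >-> A <= B}.
Proof.
move=> A B AB; apply: ereal_inf_le_tmp => _ [P [cP le_ab BP] <-].
by exists P => //; split=> //; exact: subset_trans BP.
Qed.

Lemma lebesgue_outer_sigma_subadditive : sigma_subadditive lebesgue_outer.
Proof.
move=> F; have [[i Fioo]|] := pselect (exists i, lebesgue_outer (F i) = +oo).
  rewrite (eseries_pinfty _ _ Fioo) ?leey// => k _.
  by rewrite -ltNye (lt_le_trans _ (lebesgue_outer_ge0 _)).
rewrite -forallNE => Foo.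
apply/lee_addgt0Pr => _/posnumP[e].
rewrite (le_trans _ (epsilon_trick _ _ _))//; last first.
  by move=> k; exact: lebesgue_outer_ge0.
pose Q k P := box_cover (F k) P /\ \esum_(ab in P) (box_volume ab)%:E <=
  lebesgue_outer (F k) + (e%:num / (2 ^ k.+1)%:R)%:E.
have [G FG] : {G & forall k, Q k (G k)}.
  apply: (@choice _ _ Q) => k.
  have en1 : (0 < e%:num / (2 ^ k.+1)%:R)%R by [].
  have Fkfin : lebesgue_outer (F k) \is a fin_num.
    by rewrite ge0_fin_numE ?lebesgue_outer_ge0// ltey; exact/eqP/Foo.
  have [_ [P FkP <-] ltP] := lb_ereal_inf_adherent en1 Fkfin.
  by exists P; split => //; exact: ltW.
apply: (@le_trans _ _ (\esum_(ab in \bigcup_k G k) (box_volume ab)%:E)).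
  apply: ereal_inf_lbound; exists (\bigcup_k G k) => //; split.
  - by apply: bigcup_countable => // k _; case: (FG k) => -[].
  - by move=> ab [k _ Gkab]; case: (FG k) => -[_ + _] _; exact.
  - move=> x [k _ Fkx]; case: (FG k) => -[_ _ /(_ _ Fkx)[ab Gkab abx]] _.
    by exists ab => //; exists k.
pose v ab := (Num.max (box_volume ab) 0)%:E.
have v_ge0 ab : 0 <= v ab by rewrite lee_fin le_max lexx orbT.
have Gv k ab : G k ab -> (box_volume ab)%:E = v ab.
  move=> Gkab; congr EFin; apply/esym/max_idPl.
  by rewrite -lee_fin (volume_ge0 (FG k).1).
rewrite (_ : esum _ _ = \esum_(ab in \bigcup_k G k) v ab); last first.
  by apply: eq_esum => ab [k _]; exact: Gv.
rewrite seqDU_bigcup_eq (nneseries_sum_bigcup (@trivIset_seqDU _ G))//.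
apply: lee_nneseries => k _; first by move=> _; exact: esum_ge0.
apply: le_trans (FG k).2; rewrite (eq_esum (Gv k)).
apply: ereal_sup_le => _ [X [Xfin XG] <-]; exists X => //; split => //.
exact: subset_trans XG (@subset_seqDU _ G k).
Qed.

HB.instance Definition _ := isOuterMeasure.Build R 'rV[R]_n lebesgue_outer
  lebesgue_outer0 lebesgue_outer_ge0 le_lebesgue_outer
  lebesgue_outer_sigma_subadditive.

End lebesgue.

(* R^n with the sigma-algebra of Lebesgue measurable sets, defined by the
   Caratheodory criterion. *)
Notation Rn R n := (caratheodory_type (@lebesgue_outer R n)).

Definition lebn {R : realType} {n : nat} : set (Rn R n) -> \bar R :=
  @lebesgue_outer R n.

HB.instance Definition _ (R : realType) (n : nat) :=
  isMeasure.Build _ (Rn R n) R (@lebn R n)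
    (caratheodory_measure0 (@lebesgue_outer R n))
    (caratheodory_measure_ge0 (mu := @lebesgue_outer R n))
    (@caratheodory_measure_sigma_additive R _ (@lebesgue_outer R n)).

Section euclidean.
Context {R : realType} {n : nat}.
Implicit Types (x y : 'rV[R]_n) (D : set 'rV[R]_n).

Definition enorm x : R := Num.sqrt (\sum_(i < n) x 0 i ^+ 2).

Definition eball x (r : R) : set 'rV[R]_n := [set y | enorm (x - y) < r].

Definition boundary D : set 'rV[R]_n := closure D `\` D°.

(* The value is junk (0) only if the boundary is empty, which a nonempty set of
   finite measure excludes. *)
Definition dist_boundary D x : R := inf [set enorm (x - y) | y in boundary D].

Definition domain D : Prop := [/\ open D, connected D & D !=set0].

End euclidean.

Section fractional.
Context {R : realType} {n : nat}.
Variables (delta tau : R) (Omega : set 'rV[R]_n).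
Implicit Types (u : 'rV[R]_n -> R) (p q : R) (A B : set 'rV[R]_n).

(* Elements of C(Omega) are represented by total functions; nothing below
   depends on their values outside Omega. *)
Definition Cont : set ('rV[R]_n -> R) := [set u | {within Omega, continuous u}].

Definition mean u : R :=
  (fine (lebn Omega))^-1 * \int[lebn]_(x in Omega) u x.

(* On the diagonal the integrand reads 0 / 0 = 0; the diagonal is a point. *)
Definition gfun p u (x : 'rV[R]_n) : \bar R :=
  (\int[lebn]_(y in Omega `&` eball x (tau * dist_boundary Omega x))
    (`|u x - u y| `^ p / enorm (x - y) `^ (n%:R + p * delta))%:E)%E.

(* For u not in L^1(Omega) the number [mean u] is junk, but then (q >= 1 and
   Omega of finite measure) the left-hand side is +oo whatever [mean u] is: for
   such u the inequality states that the right-hand side is +oo. *)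
Definition fractional_sobolev_poincare q p : Prop :=
  exists2 C : R, 0 < C & forall u, Cont u ->
    (\int[lebn]_(x in Omega) (`|u x - mean u| `^ q)%:E <=
      C%:E * (\int[lebn]_(x in Omega) gfun p u x) `^ (q / p))%E.

Definition test_functions A B : set ('rV[R]_n -> R) :=
  [set u | [/\ Cont u, (forall x, A x -> 1 <= u x) &
               (forall x, B x -> u x = 0)]].

(* 0 < C is no restriction, and makes C * +oo = +oo when no test function has
   finite energy. *)
Definition capacity_condition q p B : Prop :=
  exists2 C : R, 0 < C & forall A : set (Rn R n), measurable A ->
    A `<=` Omega -> A `&` B = set0 ->
    (lebn A `^ (p / q) <=
      C%:E * ereal_inf [set \int[lebn]_(x in Omega) gfun p u x
                       | u in test_functions A B])%E.

End fractional.

(* Main.v *)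
(* (i) => (ii): if the mean of a test function is at most 1/2, then
   |u - mean u| >= 1/2 on A, otherwise on the ball; in both cases Chebyshev's
   inequality bounds the measure of A by the left-hand side of (i).

   (ii) => (i): Maz'ya truncation.  For v vanishing on a ball, the slices of |v|
   between consecutive levels e 2^j are, up to scaling, test functions for the
   superlevel sets of |v|, and their energies add up to at most the energy of v;
   hence the L^q norm of v is controlled by its energy.  A general u is reduced
   to this case with two disjoint balls: a radial cutoff phi vanishes on the ball
   B(x0, r) and 1 - phi vanishes on a ball B' outside B(x0, 2r), so that (ii) for
   these two balls applies to phi (u - c) and (1 - phi) (u - c).  The energy of
   these products is at most that of u plus the p-oscillation of u about c on
   B(x0, 3r), which for small r is controlled by the energy of u if c = u y for a
   suitable point y of that ball.

   The function g_u is never shown to be measurable: the library integral of a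
   nonnegative function is the supremum of the integrals of the simple functions
   below it, and only monotonicity, superadditivity and subadditivity with one
   measurable summand are used. *)
Require Import Defs.
From mathcomp Require Import all_boot all_order all_algebra.
From mathcomp Require Import all_classical all_reals all_analysis.
From mathcomp Require Import measurable_realfun ring lra.

Set Implicit Arguments.
Unset Strict Implicit.
Unset Printing Implicit Defensive.

Import Order.TTheory GRing.Theory Num.Theory.
Import numFieldNormedType.Exports.

Local Open Scope classical_set_scope.
Local Open Scope ring_scope.

(** * Countable sums and a comparison of volumes *)

Lemma ge0_measurable_nneseries d (T : measurableType d) (R : realType)
    (D : set T) (h : nat -> T -> \bar R) :
  (forall k x, D x -> (0 <= h k x)%E) -> (forall k, measurable_fun D (h k)) ->
  measurable_fun D (fun x => \sum_(k <oo) h k x)%E.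
Proof.
move=> h0 mh.
exact: (@ge0_emeasurable_sum _ _ _ _ h predT (fun k x Dx _ => h0 k x Dx) (fun k _ => mh k)).
Qed.

(** Invert an injection of [P] into the naturals and fill the remaining indices with [x0], which
    costs nothing since [F] vanishes there. Finite and infinite [P] are thus treated alike. *)
Lemma countable_enum_esum {R : realType} (T : choiceType) (P : set T) (x0 : T)
    (F : T -> \bar R) :
  countable P -> F x0 = 0%E -> (forall x, P x -> (0 <= F x)%E) ->
  exists f : nat -> T, [/\ forall k, P (f k) \/ f k = x0,
    P `<=` range f & (\sum_(k <oo) F (f k) = \esum_(x in P) F x)%E].
Proof.
move=> /countable_injP[i iinj] Fx0 F0.
pose f k := if pselect (exists2 t, P t & i t = k) is left e
            then s2val (cid2 e) else x0.
have fP k : P (f k) \/ f k = x0.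
  by rewrite /f; case: pselect => [e|]; [left; exact: s2valP|right].
have fi t : P t -> f (i t) = t.
  move=> Pt; rewrite /f; case: pselect => [e|[]]; last by exists t.
  by apply: iinj; rewrite ?inE//; [exact: s2valP|exact: s2valP' (cid2 e)].
exists f; split => //; first by move=> t Pt; exists (i t); rewrite ?fi.
rewrite nneseries_esumT; last by move=> k; case: (fP k) => [/F0//|->]; rewrite Fx0.
rewrite (_ : esum setT _ = \esum_(k in i @` P) F (f k)).
  rewrite esum_image; first by apply: eq_esum => t /fi ->.
  by move=> x y Px Py; apply: iinj.
rewrite [RHS]esum_mkcond; apply: eq_esum => k _.
case: ifPn => // /negP; rewrite inE => nk; rewrite /f.
by case: pselect => // -[t Pt itk]; case: nk; exists t.
Qed.

(* Integrating the pointwise inequality one coordinate at a time replaces each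
   indicator by the length of the corresponding edge. *)
Lemma le_sum_prod_length {R : realType} (al be : nat -> R)
    (a b : nat -> nat -> R) (m : nat) (c : nat -> R) (K : R) :
  (forall j, al j <= be j) -> (forall k j, a k j <= b k j) ->
  0 <= K -> (forall k, 0 <= c k) ->
  (forall x : nat -> R, (forall j, (j < m)%N -> al j <= x j <= be j) ->
    (K%:E <= \sum_(k <oo)
      (c k * \prod_(j < m) \1_(`[a k j, b k j]) (x j))%:E)%E) ->
  ((K * \prod_(j < m) (be j - al j))%:E <=
    \sum_(k <oo) (c k * \prod_(j < m) (b k j - a k j))%:E)%E.
Proof.
move=> albe ab; elim: m c K => [|m IH] c K K0 c0 H.
  have := H (fun=> 0); rewrite big_ord0 mulr1 => /(_ _)/le_trans; apply => //.
  by apply: lee_nneseries => [k _ _|k _]; rewrite !big_ord0 mulr1 ?lee_fin.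
have := IH (fun k => c k * (b k m - a k m)) (K * (be m - al m)).
rewrite big_ord_recr/= mulrAC mulrA => /(_ _ _ _).
move=> IH'; apply: le_trans (IH' _ _ _) _.
- by rewrite mulr_ge0// subr_ge0.
- by move=> k; rewrite mulr_ge0// subr_ge0.
- move=> x xm; pose I := `[al m, be m]%classic : set R.
  have mI : measurable I by exact: measurable_itv.
  have muI : lebesgue_measure I = (be m - al m)%:E.
    by rewrite /I lebesgue_measure_itv/= lte_fin; case: ltgtP (albe m) => // -> _;
      rewrite subrr.
  pose p k := \prod_(j < m) \1_(`[a k j, b k j]) (x j) : R.
  have p0 k : 0 <= p k by apply: prodr_ge0 => i _; rewrite indicE.
  have -> : (K * (be m - al m))%:E = (\int[lebesgue_measure]_(t in I) K%:E)%E.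
    by rewrite integral_cst; [by rewrite EFinM -muI|exact: measurable_itv].
  apply: (@le_trans _ _ (\int[lebesgue_measure]_(t in I)
    (\sum_(k <oo) (c k * p k * \1_(`[a k m, b k m]) t)%:E))%E).
    apply: ge0_le_integral => //=.
    - apply: ge0_measurable_nneseries => [k t _|k].
        by rewrite lee_fin !mulr_ge0// indicE.
      by apply/measurable_EFinP; apply: measurable_funM.
    - move=> t It; pose x' j := if j == m then t else x j.
      have := H x'; move=> /(_ _)/le_trans; apply.
        move=> j; rewrite ltnS leq_eqVlt /x'; case: eqP => [-> _|_ /= /xm//].
        by move: It; rewrite /I/= in_itv.
      apply: lee_nneseries => k _.
        by rewrite lee_fin mulr_ge0// prodr_ge0// => i _; rewrite indicE.
      rewrite big_ord_recr/= {2}/x' eqxx mulrA lee_fin /p.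
      rewrite (eq_bigr (fun j : 'I_m => \1_(`[a k j, b k j]) (x j)))// => j _.
      by rewrite /x' ltn_eqF.
  rewrite integral_nneseries//; last 2 first.
    by move=> k; apply/measurable_EFinP; apply: measurable_funM.
    by move=> k t _; rewrite lee_fin !mulr_ge0// indicE.
  apply: lee_nneseries => [k _ _|k _].
    by apply: integral_ge0 => t _; rewrite lee_fin !mulr_ge0// indicE.
  under eq_integral do rewrite EFinM.
  rewrite ge0_integralZl_EFin//=; [|by apply/measurable_EFinP|by rewrite mulr_ge0].
  rewrite integral_indic// mulrAC [leRHS]EFinM lee_pmul ?lee_fin ?mulr_ge0//.
  have muJ : lebesgue_measure (`[a k m, b k m]%classic : set R) =
      (b k m - a k m)%:E.
    by rewrite lebesgue_measure_itv/= lte_fin; case: ltgtP (ab k m) => // -> _;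
      rewrite subrr.
  rewrite -muJ; apply: measureIl => //; exact: measurable_itv.
- apply: lee_nneseries => [k _ _|k _].
    rewrite lee_fin mulr_ge0 ?mulr_ge0 ?subr_ge0//.
    by rewrite prodr_ge0// => i _; rewrite subr_ge0.
  by rewrite big_ord_recr/= lee_fin [leRHS]mulrA mulrAC.
Qed.

(** * Lebesgue measure on R^n: volume of boxes, measurability of open sets *)

Section lebesgue_measure_Rn.
Context {R : realType} {n : nat}.
Hypothesis n0 : (0 < n)%N.
Implicit Types (A : set 'rV[R]_n) (ab : 'rV[R]_n * 'rV[R]_n).

(** Degenerate boxes at the origin serve as padding; their volume is 0 because [n] is positive. *)
Lemma box_cover_seq A P : box_cover A P ->
  exists f : nat -> 'rV[R]_n * 'rV[R]_n,
    [/\ forall k i, (f k).1 0 i <= (f k).2 0 i, A `<=` \bigcup_k box (f k) &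
       (\sum_(k <oo) (box_volume (f k))%:E =
        \esum_(ab in P) (box_volume ab)%:E)%E].
Proof.
move=> [cP le_ab AP].
have [||f [fP Pf fE]] := @countable_enum_esum R _ P (0, 0)
    (fun ab => (box_volume ab)%:E) cP.
- rewrite /box_volume (bigD1 (Ordinal n0))//= !mxE subrr mul0r//.
- by move=> ab Pab; rewrite lee_fin prodr_ge0// => i _; rewrite subr_ge0 le_ab.
exists f; split => //.
  by move=> k i; case: (fP k) => [/le_ab //|->].
by move=> x /AP[ab /Pf[k _ <-] abx]; exists k.
Qed.

Lemma lebesgue_outer_box_le ab : (forall i, ab.1 0 i <= ab.2 0 i) ->
  (lebesgue_outer (box ab) <= (box_volume ab)%:E)%E.
Proof.
move=> le_ab; apply: ereal_inf_lbound; exists [set ab].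
  by split => [|_ -> //|x abx]; [exact: countable1|exists ab].
rewrite esum_set1// lee_fin prodr_ge0// => i _; rewrite subr_ge0; exact: le_ab.
Qed.

Lemma lebesgue_outer_le_sum A (f : nat -> 'rV[R]_n * 'rV[R]_n) :
  (forall k i, (f k).1 0 i <= (f k).2 0 i) -> A `<=` \bigcup_k box (f k) ->
  (lebesgue_outer A <= \sum_(k <oo) (box_volume (f k))%:E)%E.
Proof.
move=> le_f Af; apply: (le_trans (le_lebesgue_outer Af)).
apply: (le_trans (lebesgue_outer_sigma_subadditive _)).
apply: lee_nneseries => [k _ _|k _]; first exact: lebesgue_outer_ge0.
exact: lebesgue_outer_box_le.
Qed.

(** For the lower bound, the indicators of the covering boxes add up to at least 1 on the box, and
    [le_sum_prod_length] turns this into a comparison of volumes. *)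
Lemma lebesgue_outer_box ab : (forall i, ab.1 0 i <= ab.2 0 i) ->
  lebesgue_outer (box ab) = (box_volume ab)%:E.
Proof.
move=> le_ab; apply/eqP; rewrite eq_le lebesgue_outer_box_le//=.
apply: le_ereal_inf_tmp => _ [P /box_cover_seq[f [le_f Af <-]] <-].
(* [le_sum_prod_length] numbers coordinates by [nat]. Indices beyond [n] are read as 0: the edges
   stay ordered and the products do not see them. *)
pose j k : 'I_n := insubd (Ordinal n0) k.
have jE (i : 'I_n) : j i = i by apply: val_inj; rewrite val_insubd ltn_ord.
have := @le_sum_prod_length R (fun k => ab.1 0 (j k)) (fun k => ab.2 0 (j k))
  (fun k i => (f k).1 0 (j i)) (fun k i => (f k).2 0 (j i)) n (fun=> 1) 1.
rewrite mul1r; under eq_bigr do rewrite jE.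
move=> /(_ _ _ _ _ _)/le_trans; apply => //; last first.
  apply: lee_nneseries => [k _ _|k _].
    by rewrite lee_fin mul1r prodr_ge0// => i _; rewrite subr_ge0.
  by rewrite mul1r; under eq_bigr do rewrite jE.
move=> x xab; pose y : 'rV[R]_n := \row_i x i.
have /Af[k _ fky] : box ab y.
  by move=> i; rewrite mxE; have := xab i (ltn_ord i); rewrite jE.
have t0 i : (0 <= (1 * \prod_(j0 < n)
    \1_(`[(f i).1 0 (j j0), (f i).2 0 (j j0)]) (x j0) : R)%:E)%E.
  by rewrite lee_fin mul1r prodr_ge0// => i' _; rewrite indicE.
(* The partial sum through index [k] already contains the term of the box around [y], which is 1. *)
apply: le_trans (nneseries_lim_ge k.+1 _) => //.
rewrite big_mkord big_ord_recr/= mul1r [X in (_ <= _ + X%:E)%E]big1; last first.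
  move=> i _; rewrite indicE jE mem_set//= in_itv/=.
  by have := fky i; rewrite mxE.
by rewrite leeDr// sume_ge0.
Qed.

(** Caratheodory's criterion holds because the hyperplane cuts each box of a cover into two boxes
    whose volumes add up to the volume of that box. *)
Lemma measurable_halfspace (i : 'I_n) (t : R) :
  measurable ([set x : Rn R n | x 0 i <= t] : set (Rn R n)).
Proof.
apply: le_caratheodory_measurable => X.
apply: le_ereal_inf_tmp => _ [P /box_cover_seq[f [le_f Xf <-]] <-].
(* [m k] is [t] clamped to the edge of the box, so that a box lying on one side of the hyperplane
   leaves a degenerate piece on the other. *)
pose m k := Num.max ((f k).1 0 i) (Num.min ((f k).2 0 i) t).
have m1 k : (f k).1 0 i <= m k by rewrite le_max lexx.
have m2 k : m k <= (f k).2 0 i by rewrite ge_max le_f ge_min lexx.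
pose f1 k : 'rV[R]_n * 'rV[R]_n :=
  ((f k).1, \row_j if j == i then m k else (f k).2 0 j).
pose f2 k : 'rV[R]_n * 'rV[R]_n :=
  (\row_j (if j == i then m k else (f k).1 0 j), (f k).2).
have le_f1 k j : (f1 k).1 0 j <= (f1 k).2 0 j.
  by rewrite /f1 /= mxE; case: eqP => [->|_].
have le_f2 k j : (f2 k).1 0 j <= (f2 k).2 0 j.
  by rewrite /f2 /= mxE; case: eqP => [->|_].
have X1 : X `&` [set x | x 0 i <= t] `<=` \bigcup_k box (f1 k).
  move=> x [/Xf[k _ fkx] /= xt]; exists k => // j; rewrite /= mxE.
  have /andP[-> xj] /= := fkx j; case: eqP => // ->.
  by have /andP[_ xi] := fkx i; rewrite le_max le_min xi xt orbT.
have X2 : X `&` ~` [set x | x 0 i <= t] `<=` \bigcup_k box (f2 k).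
  move=> x [/Xf[k _ fkx] /= /negP]; rewrite -ltNge => tx.
  exists k => // j; rewrite /= mxE.
  have /andP[xj ->] := fkx j; rewrite andbT; case: eqP => // ->.
  by have /andP[xi _] := fkx i; rewrite ge_max xi ge_min (ltW tx) orbT.
apply: (le_trans (leeD (lebesgue_outer_le_sum le_f1 X1)
                       (lebesgue_outer_le_sum le_f2 X2))).
have vol0 (g : nat -> 'rV[R]_n * 'rV[R]_n) : (forall k i, (g k).1 0 i <= (g k).2 0 i) ->
    forall k, 0 <= box_volume (g k).
  by move=> h k; rewrite prodr_ge0// => j _; rewrite subr_ge0 h.
rewrite -nneseriesD; [|by move=> *; rewrite lee_fin vol0..].
apply: lee_nneseries => [k _ _|k _]; first by rewrite adde_ge0// lee_fin vol0.
rewrite -EFinD lee_fin /box_volume [X in X + _](bigD1 i)// [X in _ + X](bigD1 i)//=.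
rewrite [leRHS](bigD1 i)//= !mxE eqxx.
rewrite (eq_bigr (fun j => (f k).2 0 j - (f k).1 0 j)); last first.
  by move=> j /negPf ji; rewrite mxE ji.
rewrite [X in _ + _ * X](eq_bigr (fun j => (f k).2 0 j - (f k).1 0 j)); last first.
  by move=> j /negPf ji; rewrite mxE ji.
by rewrite -mulrDl addrC subrKA.
Qed.

Lemma measurable_coord (i : 'I_n) :
  measurable_fun [set: Rn R n] (fun x : Rn R n => x 0 i : R).
Proof.
apply: (measurability _ (RGenOInfty.measurableE R)) => //.
move=> _ [_ [t ->] <-]; rewrite setTI (_ : _ @^-1` _ = ~` [set x : Rn R n | x 0 i <= t]).
  by apply: measurableC; exact: measurable_halfspace.
apply/seteqP; split => x /=; rewrite in_itv/= andbT ltNge; first by move=> /negP.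
by move=> /negP.
Qed.

Lemma measurable_box ab : measurable (box ab : set (Rn R n)).
Proof.
rewrite (_ : box ab = ~` \bigcup_i ~` ([set x : Rn R n | ab.1 0 i <= x 0 i] `&`
    [set x : Rn R n | x 0 i <= ab.2 0 i])).
  apply: measurableC; apply: countable_bigcupT_measurable => [|i].
    exact: countableP.
  apply: measurableC; apply: measurableI; last exact: measurable_halfspace.
  rewrite -[X in measurable X]setTI.
  rewrite (_ : [set x : Rn R n | ab.1 0 i <= x 0 i] =
    (fun x : Rn R n => x 0 i : R) @^-1` `[ab.1 0 i, +oo[).
    by apply: measurable_coord => //; exact: measurable_itv.
  by apply/seteqP; split => x /=; rewrite in_itv/= andbT.
apply/seteqP; split => x.
  by move=> abx [i _] /=; case; apply/andP; exact: abx.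
move=> /= h i; apply/andP; apply: contrapT => ni; apply: h; exists i => //.
Qed.

(** An open set is the union of the boxes with rational corners that it contains, and these are
    countably many. *)
Lemma open_measurable_Rn (U : set 'rV[R]_n) : open U ->
  measurable (U : set (Rn R n)).
Proof.
move=> oU; pose Q := ('rV[rat]_n * 'rV[rat]_n)%type.
pose B (ab : Q) : set 'rV[R]_n := box (map_mx ratr ab.1, map_mx ratr ab.2).
rewrite (_ : U = \bigcup_(ab : Q) if pselect (B ab `<=` U) then B ab else set0).
  apply: countable_bigcupT_measurable => [|ab]; first exact: countableP.
  by case: pselect => /= _; [exact: measurable_box|exact: measurable0].
apply/seteqP; split => x; last by move=> [ab _]; case: pselect => [BU /BU|].
move=> Ux; have /nbhs_ballP[e /= e0 xeU] : nbhs x U by exact: open_nbhs_nbhs.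
have [a ha] : {a : 'rV[rat]_n & forall i, x 0 i - e < ratr (a 0 i) < x 0 i}.
  have ex i : exists q : rat, x 0 i - e < ratr q < x 0 i.
    have [|q] := @rat_in_itvoo R (x 0 i - e) (x 0 i); first by rewrite ltrBlDr ltrDl.
    by rewrite in_itv; exists q.
  have [f fP] := choice ex.
  by exists (\row_i f i) => i; rewrite mxE.
have [b hb] : {b : 'rV[rat]_n & forall i, x 0 i < ratr (b 0 i) < x 0 i + e}.
  have ex i : exists q : rat, x 0 i < ratr q < x 0 i + e.
    have [|q] := @rat_in_itvoo R (x 0 i) (x 0 i + e); first by rewrite ltrDl.
    by rewrite in_itv; exists q.
  have [f fP] := choice ex.
  by exists (\row_i f i) => i; rewrite mxE.
exists (a, b) => //; case: pselect => /= [_ i|[]].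
  by rewrite !mxE; have /andP[_ /ltW->] := ha i; have /andP[/ltW->] := hb i.
move=> y aby; apply: xeU; split => // i j; rewrite (ord1 i) /ball/=.
have := aby j; rewrite /= !mxE => /andP[ay yb].
have /andP[xa _] := ha j; have /andP[_ bx] := hb j.
rewrite ltr_distlC (lt_le_trans xa)//= (le_lt_trans yb)//.
Qed.

End lebesgue_measure_Rn.

(** * The Euclidean norm and its topology *)

Section euclidean_norm.
Context {R : realType} {n : nat}.
Implicit Types (x y z : 'rV[R]_n).

Lemma enorm_ge0 x : 0 <= enorm x.
Proof. exact: sqrtr_ge0. Qed.

Lemma enorm_sqr x : enorm x ^+ 2 = \sum_(i < n) x 0 i ^+ 2.
Proof. by rewrite sqr_sqrtr// sumr_ge0// => i _; exact: sqr_ge0. Qed.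

Lemma enormN x : enorm (- x) = enorm x.
Proof. by congr Num.sqrt; apply: eq_bigr => i _; rewrite mxE sqrrN. Qed.

Lemma enormC x y : enorm (x - y) = enorm (y - x).
Proof. by rewrite -enormN opprB. Qed.

Lemma le_coord_enorm x i : `|x 0 i| <= enorm x.
Proof.
rewrite -(@ler_pXn2r _ 2)// ?nnegrE ?enorm_ge0// enorm_sqr real_normK ?num_real//.
by rewrite (bigD1 i)//= lerDl sumr_ge0// => j _; exact: sqr_ge0.
Qed.

(** For nonzero vectors, sum a b <= (a^2 + b^2) / 2 over the coordinates of the normalized
    vectors. *)
Lemma cauchy_schwarz_row x y :
  \sum_(i < n) x 0 i * y 0 i <= enorm x * enorm y.
Proof.
have [x0|x0] := eqVneq (enorm x) 0.
  rewrite x0 mul0r big1// => i _; have := le_coord_enorm x i.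
  by rewrite x0 normr_le0 => /eqP->; rewrite mul0r.
have [y0|y0] := eqVneq (enorm y) 0.
  rewrite y0 mulr0 big1// => i _; have := le_coord_enorm y i.
  by rewrite y0 normr_le0 => /eqP->; rewrite mulr0.
have xy0 : 0 < enorm x * enorm y by rewrite mulr_gt0// lt_def ?x0 ?y0 enorm_ge0.
rewrite -[leRHS]mul1r -ler_pdivrMr// mulr_suml.
apply: (@le_trans _ _ (\sum_(i < n)
    ((x 0 i ^+ 2 / enorm x ^+ 2) + (y 0 i ^+ 2 / enorm y ^+ 2)) / 2)).
  apply: ler_sum => i _; rewrite invfM mulrACA -!expr_div_n.
  by have := sqr_ge0 (x 0 i / enorm x - y 0 i / enorm y); rewrite !expr2; lra.
rewrite -mulr_suml big_split/= -!mulr_suml -!enorm_sqr !divff ?expf_neq0//.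
Qed.

Lemma ler_enormD x y : enorm (x + y) <= enorm x + enorm y.
Proof.
rewrite -(@ler_pXn2r _ 2)// ?nnegrE ?addr_ge0 ?enorm_ge0//.
rewrite sqrrD !enorm_sqr.
rewrite (eq_bigr (fun i => x 0 i ^+ 2 + y 0 i ^+ 2 + 2 * (x 0 i * y 0 i))); last first.
  by move=> i _; rewrite mxE sqrrD mulr_natl addrAC.
rewrite !big_split/= -mulr_sumr addrAC lerD2r lerD2l -[leRHS]mulr_natl ler_pM2l//.
exact: cauchy_schwarz_row.
Qed.

Lemma ler_enormB z x y : enorm (x - y) <= enorm (x - z) + enorm (z - y).
Proof. by rewrite -[x - y](subrKA z) ler_enormD. Qed.

Lemma enorm_le_sum x : enorm x <= \sum_(i < n) `|x 0 i|.
Proof.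
rewrite -(@ler_pXn2r _ 2)// ?nnegrE ?enorm_ge0 ?sumr_ge0// enorm_sqr.
rewrite expr2 mulr_suml; apply: ler_sum => i _.
rewrite -real_normK ?num_real// expr2 ler_wpM2l// (bigD1 i)//= lerDl.
exact: sumr_ge0.
Qed.

(** Links the Euclidean norm to the library topology, whose balls are cubes. *)
Lemma lipschitz_enorm_continuous (f : 'rV[R]_n -> R) (L : R) :
  (forall x y, `|f x - f y| <= L * enorm (x - y)) -> continuous f.
Proof.
move=> fL x; apply/(@cvgrPdist_lt _ _ _ (nbhs x) (nbhs_filter x)) => e e0.
(* In a cube of half-edge [e / L'] the Euclidean distance to the centre is at most [n] times this
   half-edge. The added 1 makes [L'] positive and the final inequality strict. *)
pose L' := Num.max L 0 * n%:R + 1.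
have L'0 : 0 < L' by rewrite ltr_wpDl// mulr_ge0// le_max lexx orbT.
apply/nbhs_ballP; exists (e / L') => /=; first exact: divr_gt0.
move=> y [_ xy]; apply: le_lt_trans (fL _ _) _.
apply: (@le_lt_trans _ _ (Num.max L 0 * (\sum_(i < n) e / L'))).
  apply: (@le_trans _ _ (Num.max L 0 * enorm (x - y))).
    by rewrite ler_wpM2r ?enorm_ge0// le_max lexx.
  rewrite ler_wpM2l// ?le_max ?lexx ?orbT//.
  apply: le_trans (enorm_le_sum _) _; apply: ler_sum => i _.
  by rewrite !mxE ltW// (xy 0 i).
rewrite sumr_const card_ord -[_ *+ n]mulr_natr [_ / _ * _]mulrAC.
rewrite mulrA mulrA ltr_pdivrMr// [ltRHS]mulrC [X in X * _]mulrC -mulrA.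
by rewrite [ltRHS]mulrC ltr_pM2l// /L' ltrDl.
Qed.

Lemma continuous_enormB x : continuous (fun y : 'rV[R]_n => enorm (y - x)).
Proof.
apply: (@lipschitz_enorm_continuous _ 1) => y z; rewrite mul1r.
have h (a b : 'rV[R]_n) : enorm (a - x) - enorm (b - x) <= enorm (a - b).
  by rewrite lerBlDr ler_enormB.
by rewrite ler_norml lerNl opprB (enormC y z) h -(enormC y z) h.
Qed.

Lemma eball_open x r : open (eball x r).
Proof.
rewrite (_ : eball x r = (fun y => enorm (y - x)) @^-1` [set t | t < r]).
  apply: open_comp; [by move=> y _; exact: continuous_enormB|exact: open_lt].
by apply/seteqP; split => y; rewrite /eball /= enormC.
Qed.

End euclidean_norm.

(** * Measure of Euclidean balls *)

Section ball_measure.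
Context {R : realType} {n : nat}.
Hypothesis n0 : (0 < n)%N.
Implicit Types (x y z : 'rV[R]_n).

Lemma measurable_eball x r : measurable (eball x r : set (Rn R n)).
Proof. exact/open_measurable_Rn/eball_open. Qed.

Lemma lebn_cube x (r : R) : 0 <= r ->
  lebn (box (x - const_mx r, x + const_mx r)) = ((2 * r) ^+ n)%:E.
Proof.
move=> r0; rewrite /lebn lebesgue_outer_box//=; last first.
  by move=> i; rewrite !mxE; lra.
rewrite /box_volume (eq_bigr (fun=> 2 * r)); last by move=> i _; rewrite !mxE/=; lra.
by rewrite prodr_const card_ord.
Qed.

Lemma lebn_eball_le x (r : R) : 0 <= r -> (lebn (eball x r) <= ((2 * r) ^+ n)%:E)%E.
Proof.
move=> r0; rewrite -(lebn_cube x r0); apply: le_lebesgue_outer => y xy i.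
rewrite /= !mxE -ler_distlC.
by rewrite (le_trans _ (ltW xy))// (le_trans _ (le_coord_enorm _ i))// !mxE.
Qed.

(** The ball contains the concentric cube of half-edge [r / (2 * n)], since the norm is at most the
    sum of the absolute coordinates. *)
Lemma lebn_eball_gt0 x (r : R) : 0 < r -> (0 < lebn (eball x r))%E.
Proof.
move=> r0; pose s := r / (2 * n%:R).
have n0' : (0 : R) < n%:R by rewrite ltr0n.
have s0 : 0 < s by rewrite divr_gt0// mulr_gt0.
have := lebn_cube x (ltW s0) => cE.
apply: (@lt_le_trans _ _ ((2 * s) ^+ n)%:E).
  by rewrite lte_fin exprn_gt0// mulr_gt0.
rewrite -cE; apply: le_lebesgue_outer => y xy.
apply: le_lt_trans (enorm_le_sum _) _.
apply: (@le_lt_trans _ _ (\sum_(i < n) s)).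
  apply: ler_sum => i _; rewrite !mxE.
  by have := xy i; rewrite /= !mxE -ler_distlC.
rewrite sumr_const card_ord -[_ *+ n]mulr_natr /s invfM mulrA.
rewrite divfK ?gt_eqF// ltr_pdivrMr// ltr_pMr// ltr1n //.
Qed.

Lemma lebn_setT : lebn (setT : set (Rn R n)) = +oo%E.
Proof.
apply/eqyP => K K0.
have h : 1 <= 2 * (K + 1) by lra.
apply: (@le_trans _ _ ((2 * (K + 1)) ^+ n)%:E).
  rewrite lee_fin (@le_trans _ _ (2 * (K + 1)))//; first by lra.
  by rewrite ler_eXnr.
rewrite -(@lebn_cube 0 (K + 1)); first exact: le_lebesgue_outer.
by lra.
Qed.

End ball_measure.

(** * Continuous functions on an open set and the distance to its boundary *)

Section domains.
Context {R : realType} {n : nat}.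
Hypothesis n0 : (0 < n)%N.
Variable Omega : set 'rV[R]_n.
Hypothesis oO : open Omega.
Implicit Types (u f g : 'rV[R]_n -> R) (x y : 'rV[R]_n).

Lemma ContP u : Cont Omega u <-> (forall x, Omega x -> {for x, continuous u}).
Proof.
rewrite /Cont /= continuous_open_subspace//; split => [uc x Ox|uc x].
  by apply: uc; rewrite inE.
by rewrite inE => /uc.
Qed.

Lemma Cont_measurable u : Cont Omega u ->
  measurable_fun (Omega : set (Rn R n)) (u : Rn R n -> R).
Proof.
move=> /ContP uc; apply: (measurability _ (RGenOInfty.measurableE R)) => //.
move=> _ [_ [t ->] <-]; apply: (open_measurable_Rn n0).
rewrite openE => x [Ox ux].
have : nbhs x (u @^-1` `]t, +oo[).
  apply: uc => //; apply: open_nbhs_nbhs; split => //.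
have : nbhs x Omega by exact: open_nbhs_nbhs.
exact: filterI.
Qed.

Lemma Cont_measurable_powR u (q : R) : Cont Omega u ->
  measurable_fun (Omega : set (Rn R n)) (fun x : Rn R n => `|u x| `^ q).
Proof.
move=> uc; apply: (measurableT_comp (measurable_powR q)).
by apply: measurableT_comp => //; exact: Cont_measurable.
Qed.

(** Meant for compositions of [f] with Lipschitz maps, such as translations and truncations. *)
Lemma Cont_lipschitz f g (L : R) : Cont Omega f ->
  (forall x y, Omega x -> Omega y -> `|g x - g y| <= L * `|f x - f y|) ->
  Cont Omega g.
Proof.
move=> /ContP fc gf; apply/ContP => x Ox.
apply/(@cvgrPdist_lt _ _ _ (nbhs x) (nbhs_filter x)) => e e0.
pose M := Num.max L 1; have M0 : 0 < M by rewrite lt_max ltr01 orbT.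
have /(@cvgrPdist_lt _ _ _ (nbhs x) (nbhs_filter x)) := fc _ Ox.
move=> /(_ (e / M)); rewrite divr_gt0// => /(_ isT) fx.
have xO : nbhs x Omega by exact: open_nbhs_nbhs.
apply: filterS2 xO fx => y Oy; rewrite ltr_pdivlMr// mulrC.
apply: le_lt_trans; apply: le_trans (gf _ _ Ox Oy) _.
by rewrite ler_wpM2r// le_max lexx.
Qed.

Lemma ContB_cst u c : Cont Omega u -> Cont Omega (fun x => u x - c).
Proof.
move=> uc; apply: (Cont_lipschitz uc (L := 1)) => x y _ _.
by rewrite mul1r opprB addrA subrK.
Qed.

Lemma ContM f g : Cont Omega f -> Cont Omega g -> Cont Omega (fun x => f x * g x).
Proof.
move=> /ContP fc /ContP gc; apply/ContP => x Ox.
exact: (cvgM (fc _ Ox) (gc _ Ox)).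
Qed.

Lemma continuous_Cont f : continuous f -> Cont Omega f.
Proof. by move=> fc; apply/ContP => x _; exact: fc. Qed.

(** Without boundary, [Omega] would be open and closed. By connectedness of [0, 1], the segment from
    [a] to any point would stay inside, so [Omega] would be the whole space, of infinite measure. *)
Lemma boundary_nonempty : Omega !=set0 ->
  (lebn Omega < +oo)%E -> boundary Omega !=set0.
Proof.
move=> [a Oa] fin; apply: contrapT => /nonemptyPn bd0.
have clO : closure Omega `<=` Omega.
  move=> x cx; apply: contrapT => nOx.
  suff : boundary Omega x by rewrite bd0.
  by split => // /interior_subset.
suff OT : Omega = setT by move: fin; rewrite OT lebn_setT.
apply/seteqP; split => // b _.
pose g (t : R) : 'rV[R]_n := a + t *: (b - a).
have gc : continuous g.
  move=> t; apply: cvgD; first exact: cvg_cst.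
  apply: cvgZr_tmp; exact: cvg_id.
have gO : `[0, 1]%classic `&` g @^-1` Omega = `[0, 1]%classic.
  apply: segment_connected.
  - by exists 0; split; rewrite /= ?in_itv/= ?lexx ?ler01// /g scale0r addr0.
  - by exists (g @^-1` Omega) => //; apply: open_comp => // t _; exact: gc.
  - exists (g @^-1` closure Omega).
      apply: preimage_closed => //; exact: closed_closure.
    by congr (_ `&` _ @^-1` _); apply/seteqP; split => //; exact: subset_closure.
have : `[0, 1]%classic (1 : R) by rewrite /= in_itv/= ler01 lexx.
by rewrite -gO => -[_]; rewrite /g /= scale1r addrC subrK.
Qed.

(** A boundary point of an open set is not in the set, hence not in the ball of radius [2 * rho],
    whereas everything within [rho] of [x] is in that ball. *)
Lemma dist_boundary_ge (x0 x : 'rV[R]_n) (rho : R) : boundary Omega !=set0 ->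
  eball x0 (2 * rho) `<=` Omega -> eball x0 rho x -> rho <= dist_boundary Omega x.
Proof.
move=> [b bd] BO x0x; apply: lb_le_inf; first by exists (enorm (x - b)), b.
move=> _ [y [_ nOy] <-]; rewrite leNgt; apply/negP => xy.
apply: nOy; move: oO; rewrite openE; apply; apply: BO; apply: le_lt_trans (ler_enormB x _ _) _.
by rewrite mulrDl mul1r ltrD.
Qed.

End domains.

(** * Integrals of nonnegative functions as suprema over simple functions *)

Section lower_integral.
Local Open Scope ereal_scope.
Context d (T : measurableType d) (R : realType).
Variable mu : {measure set T -> \bar R}.
Implicit Types (f g k : T -> \bar R).

Import HBNNSimple.

Lemma ge0_le_lower_integral (D : set T) f g : (forall x, D x -> 0 <= f x) ->
  (forall x, D x -> f x <= g x) ->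
  \int[mu]_(x in D) f x <= \int[mu]_(x in D) g x.
Proof.
move=> f0 fg; have g0 x : D x -> 0 <= g x.
  by move=> Dx; apply: le_trans (fg _ Dx); exact: f0.
rewrite !ge0_integralE//; apply: le_ereal_sup => _ [h hf <-].
exists h => // x; apply: (le_trans (hf x)).
by rewrite /patch; case: ifPn => //; rewrite inE => /fg.
Qed.

Lemma ge0_lower_integralZl_le (D : set T) (c : R) f : (0 < c)%R ->
  (forall x, D x -> 0 <= f x) ->
  \int[mu]_(x in D) (c%:E * f x) <= c%:E * \int[mu]_(x in D) f x.
Proof.
move=> c0 f0; rewrite [leLHS]ge0_integralE; last first.
  by move=> x Dx; rewrite mule_ge0 ?f0// lee_fin ltW.
apply: ge_ereal_sup => _ [h hf <-].
rewrite -lee_pdivrMl//.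
have ci0 : (0 <= c^-1)%R by rewrite invr_ge0 ltW.
have -> : c^-1%:E * sintegral mu h = sintegral mu (scale_nnsfun h ci0).
  by rewrite sintegralrM.
rewrite ge0_integralE//; apply: ereal_sup_ubound; exists (scale_nnsfun h ci0) => // x /=.
rewrite EFinM lee_pdivrMl//; apply: (le_trans (hf x)).
by rewrite /patch; case: ifPn => //; rewrite mule0.
Qed.

(** The sum of a simple function below [f] and one below [g] is a simple function below [k]. *)
Lemma ge0_lower_integralD_le (D : set T) f g k : (forall x, D x -> 0 <= f x) ->
  (forall x, D x -> 0 <= g x) -> (forall x, D x -> f x + g x <= k x) ->
  \int[mu]_(x in D) f x + \int[mu]_(x in D) g x <= \int[mu]_(x in D) k x.
Proof.
move=> f0 g0 fgk.
have k0 x : D x -> 0 <= k x.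
  by move=> Dx; apply: le_trans (fgk _ Dx); rewrite adde_ge0 ?f0 ?g0.
(* The value +oo is trivial. Otherwise the integrals are finite, so terms can be moved across the
   inequality and the two suprema taken one at a time. *)
have [->|koo] := eqVneq (\int[mu]_(x in D) k x) +oo; first by rewrite leey.
have kfin : \int[mu]_(x in D) k x \is a fin_num.
  by rewrite ge0_fin_numE ?integral_ge0// ltey.
have gk : \int[mu]_(x in D) g x <= \int[mu]_(x in D) k x.
  by apply: ge0_le_lower_integral => // x Dx; apply: le_trans (fgk _ Dx); rewrite leeDr ?f0.
have gfin : \int[mu]_(x in D) g x \is a fin_num.
  by rewrite ge0_fin_numE ?integral_ge0// (le_lt_trans gk)// ltey.
have st_le (s t : {nnsfun T >-> R}) : (forall x, (s x)%:E <= (f \_ D) x) ->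
    (forall x, (t x)%:E <= (g \_ D) x) ->
    sintegral mu s + sintegral mu t <= \int[mu]_(x in D) k x.
  move=> sf tg; rewrite -sintegralD ge0_integralE//.
  apply: ereal_sup_ubound; exists (add_nnsfun s t) => // x /=.
  rewrite EFinD; apply: (le_trans (leeD (sf x) (tg x))).
  by rewrite /patch; case: ifPn => [|_]; [rewrite inE => /fgk|rewrite adde0].
rewrite -leeBrDr// [leLHS]ge0_integralE//; apply: ge_ereal_sup => _ [s sf <-].
have sfin : sintegral mu s \is a fin_num.
  rewrite ge0_fin_numE ?sintegral_ge0// (@le_lt_trans _ _ (\int[mu]_(x in D) k x)) ?ltey//.
  have := st_le s nnsfun0 sf; rewrite sintegral0 adde0; apply => x.
  by rewrite /patch; case: ifPn => //; rewrite inE => /g0.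
rewrite leeBrDr// addeC -leeBrDr// [leLHS]ge0_integralE//.
apply: ge_ereal_sup => _ [t tg <-].
by rewrite leeBrDr// addeC st_le.
Qed.

Lemma ge0_lower_integral_sum_le (D : set T) (f : nat -> T -> \bar R) k N :
  (forall j x, D x -> 0 <= f j x) ->
  (forall x, D x -> \sum_(j < N) f j x <= k x) ->
  \sum_(j < N) \int[mu]_(x in D) f j x <= \int[mu]_(x in D) k x.
Proof.
move=> f0; elim: N k => [k k0|N IH k fk].
  rewrite big_ord0 integral_ge0// => x /k0; by rewrite big_ord0.
rewrite big_ord_recr/=.
have S0 x : D x -> 0 <= \sum_(j < N) f j x by move=> Dx; rewrite sume_ge0// => j _; exact: f0.
apply: le_trans (@ge0_lower_integralD_le D (fun x => \sum_(j < N) f j x) (f N) k S0 (f0 N) _).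
  by rewrite leeD2r// IH.
by move=> x /fk; rewrite big_ord_recr.
Qed.

(** For a simple [s] below [f], the positive part of [s - h] is measurable and lies below [g].
    Additivity is then applied only to this function and [h], both measurable. *)
Lemma ge0_lower_integral_leD (D : set T) (mD : measurable D) f g (h : T -> R) :
  (forall x, D x -> 0 <= f x) -> (forall x, D x -> 0 <= g x) ->
  (forall x, D x -> 0 <= h x)%R -> measurable_fun D h ->
  (forall x, D x -> f x <= g x + (h x)%:E) ->
  \int[mu]_(x in D) f x <= \int[mu]_(x in D) g x + \int[mu]_(x in D) (h x)%:E.
Proof.
move=> f0 g0 h0 mh fgh; rewrite [leLHS]ge0_integralE//.
apply: ge_ereal_sup => _ [s sf <-].
pose t x := Num.max (s x - h x)%R 0%R.
have mt : measurable_fun D t.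
  by apply: measurable_maxr => //; apply: measurable_funB => //; exact: measurable_funTS.
apply: (@le_trans _ _ (\int[mu]_(x in D) ((t x)%:E + (h x)%:E))).
  rewrite -integralT_nnsfun [leRHS]integral_mkcond.
  apply: ge0_le_lower_integral => x _; first by rewrite lee_fin.
  have := sf x; rewrite /patch; case: ifPn => //; rewrite inE => Dx _.
  by rewrite -EFinD lee_fin -lerBlDr le_max lexx.
have t0 x : D x -> 0 <= (t x)%:E by rewrite lee_fin le_max lexx orbT.
have h0' x : D x -> 0 <= (h x)%:E by move=> Dx; rewrite lee_fin h0.
rewrite (ge0_integralD mu mD t0 _ h0')//; [|exact/measurable_EFinP..].
rewrite leeD2r//; apply: ge0_le_lower_integral => x Dx.
  by rewrite lee_fin le_max lexx orbT.
rewrite /t EFin_max ge_max g0// andbT EFinB leeBlDr//.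
by apply: le_trans (fgh _ Dx); have := sf x; rewrite /patch mem_set.
Qed.

End lower_integral.

(** Chebyshev's inequality: [k] times the indicator of [S] lies below [f]. *)
Lemma ge0_lower_markov d (T : measurableType d) (R : realType)
    (mu : {measure set T -> \bar R}) (D S : set T) (f : T -> \bar R) (k : R) :
  measurable D -> measurable S -> S `<=` D -> 0 <= k ->
  (forall x, D x -> (0 <= f x)%E) -> (forall x, S x -> (k%:E <= f x)%E) ->
  (k%:E * mu S <= \int[mu]_(x in D) f x)%E.
Proof.
move=> mD mS SD k0 f0 kf.
have -> : (k%:E * mu S = \int[mu]_(x in D) (k * \1_S x)%:E)%E.
  rewrite (@integralZl_indic _ _ _ mu D mD (fun=> S) k)//.
    by rewrite integral_indic// setIidl.
  by rewrite ltNge k0.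
apply: ge0_le_lower_integral => x Dx; first by rewrite lee_fin mulr_ge0.
rewrite indicE; case: (boolP (x \in S)) => [|_]; last by rewrite mulr0 f0.
by rewrite inE mulr1 => /kf.
Qed.

Lemma ge0_le_poweR {R : realType} (r : R) (x y : \bar R) :
  0 <= r -> (0 <= x)%E -> (x <= y)%E -> (x `^ r <= y `^ r)%E.
Proof.
move=> r0 x0 xy; apply: gt0_ler_poweR => //; rewrite in_itv/= leey andbT//.
exact: le_trans xy.
Qed.

Lemma ler_powR_base {R : realType} (r x y : R) :
  0 <= r -> 0 <= x -> x <= y -> x `^ r <= y `^ r.
Proof.
by move=> r0 x0 xy; apply: ge0_ler_powR; rewrite ?nnegrE// (le_trans x0).
Qed.

(** * From the Sobolev-Poincaré inequality to the capacity condition *)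

Section capacity_of_sobolev.
Context {R : realType} {n : nat}.
Hypothesis n0 : (0 < n)%N.
Variables (delta tau p q : R) (Omega : set 'rV[R]_n).
Hypotheses (oO : open Omega) (fin : (lebn Omega < +oo)%E).
Hypotheses (p0 : 0 < p) (q0 : 0 < q).

Lemma gfun_ge0 u (x : 'rV[R]_n) : (0 <= gfun delta tau Omega p u x)%E.
Proof. by apply: integral_ge0 => y _; rewrite lee_fin divr_ge0 ?powR_ge0. Qed.

Lemma sobolev_capacity (c : 'rV[R]_n) (r : R) :
  0 < r -> eball c r `<=` Omega ->
  fractional_sobolev_poincare delta tau Omega q p ->
  capacity_condition delta tau Omega q p (eball c r).
Proof.
move=> r0 BO [C C0 CP].
have mO : measurable (Omega : set (Rn R n)) by exact: open_measurable_Rn.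
have mB : measurable (eball c r : set (Rn R n)) by exact: measurable_eball.
have lefin (S : set (Rn R n)) : S `<=` Omega -> lebn S \is a fin_num.
  move=> SO; rewrite ge0_fin_numE//.
  by apply: le_lt_trans fin; exact: le_lebesgue_outer.
pose b := fine (lebn (eball c r)); pose o := fine (lebn Omega).
have bE : lebn (eball c r) = b%:E by rewrite fineK// lefin.
have oE : lebn Omega = o%:E by rewrite fineK// lefin.
have b0 : 0 < b by rewrite -lte_fin -bE; exact: lebn_eball_gt0.
(* Chebyshev's inequality is applied to the [q]-th power of a quantity that is at least 1/2. *)
pose k := 2^-1 `^ q : R.
have k0 : 0 < k by rewrite powR_gt0// invr_gt0.
(* When the mean exceeds 1/2, only the measure of the ball is estimated directly, and [A] has
   measure at most that of [Omega], which is [o / b] times that of the ball. The maximum with 1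
   covers the other case. *)
pose M := Num.max 1 (o / b).
have M1 : 1 <= M by rewrite le_max lexx.
have M0 : 0 < M by rewrite (lt_le_trans _ M1).
pose K := M * (k^-1 * C); have K0 : 0 < K by rewrite !mulr_gt0// invr_gt0.
exists (K `^ (p / q)); first by rewrite powR_gt0.
move=> A mA AO AB; rewrite -lee_pdivrMl ?powR_gt0//.
apply: le_ereal_inf_tmp => _ [u [uc uA uB] <-]; rewrite lee_pdivrMl ?powR_gt0//.
set E := (\int[lebn]_(x in Omega) gfun delta tau Omega p u x)%E.
have E0 : (0 <= E)%E by apply: integral_ge0 => x _; exact: gfun_ge0.
have half (S : set (Rn R n)) : measurable S -> S `<=` Omega ->
    (forall x, S x -> 2^-1 <= `|u x - mean Omega u|) ->
    (lebn S <= (k^-1 * C)%:E * E `^ (q / p))%E.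
  move=> mS SO Su; rewrite EFinM -muleA -lee_pdivrMl ?invr_gt0// invrK.
  apply: le_trans (CP u uc); apply: ge0_lower_markov => //.
  - exact: ltW.
  - by move=> x Sx; rewrite lee_fin; apply: ler_powR_base; rewrite ?invr_ge0 ?(ltW q0) ?Su.
have AK : (lebn A <= K%:E * E `^ (q / p))%E.
  have Es0 : (0 <= (k^-1 * C)%:E * E `^ (q / p))%E.
    by rewrite mule_ge0 ?poweR_ge0// lee_fin mulr_ge0 ?invr_ge0 ?ltW.
  rewrite EFinM -muleA.
  have [m2|m2] := leP (mean Omega u) 2^-1.
    apply: (@le_trans _ _ ((k^-1 * C)%:E * E `^ (q / p))%E).
      apply: half => // x Ax; rewrite ler_normr; apply/orP; left.
      by have := uA _ Ax; lra.
    by rewrite -[leLHS]mul1e lee_wpmul2r.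
  apply: (@le_trans _ _ (lebn (Omega : set (Rn R n)))); first exact: le_lebesgue_outer.
  rewrite oE (_ : o = o / b * b)%R; last by rewrite divfK// gt_eqF.
  rewrite EFinM; apply: lee_pmul.
  - by rewrite lee_fin divr_ge0 ?fine_ge0 ?(ltW b0)//; exact: lebesgue_outer_ge0.
  - by rewrite lee_fin ltW.
  - by rewrite lee_fin le_max lexx orbT.
  - rewrite -bE; apply: half => // x Bx; rewrite ler_normr; apply/orP; right.
    by rewrite (uB _ Bx); lra.
(* Raising [AK] to the power [p / q] cancels the exponent [q / p] of the energy. *)
have pq0 : 0 <= p / q by rewrite divr_ge0// ltW.
apply: (le_trans (ge0_le_poweR pq0 _ AK)); first exact: lebesgue_outer_ge0.
rewrite poweRM ?poweR_ge0 ?lee_fin ?(ltW K0)// poweR_EFin -poweRrM.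
by rewrite mulrA divfK ?gt_eqF// divff ?gt_eqF// poweRe1.
Qed.

End capacity_of_sobolev.

(** * Inequalities for powers, and slices of a real number *)

Section power_sums.
Context {R : realType}.

(** Write t^s as t * t^(s-1); the second factor is nondecreasing in t. *)
Lemma ler_powRD (s a b : R) : 1 <= s -> 0 <= a -> 0 <= b ->
  a `^ s + b `^ s <= (a + b) `^ s.
Proof.
move=> s1 a0 b0; have s0 : 0 < s by rewrite (lt_le_trans _ s1).
have [ab0|ab0] := eqVneq (a + b) 0.
  have -> : a = 0 by lra.
  have -> : b = 0 by lra.
  by rewrite powR0 ?gt_eqF// !addr0 powR0 ?gt_eqF.
have abE t : 0 <= t -> t `^ s = t * t `^ (s - 1).
  move=> t0; have [->|tn0] := eqVneq t 0; first by rewrite mul0r powR0 ?gt_eqF.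
  by rewrite -{2}[t]powRr1// -powRD ?tn0 ?implybT// addrC subrK.
rewrite !abE ?addr_ge0// [leRHS]mulrDl.
by rewrite lerD// ler_wpM2l// ler_powR_base ?subr_ge0// ?lerDl ?lerDr.
Qed.

Lemma ler_powR_sum (s : R) (N : nat) (a : nat -> R) : 1 <= s ->
  (forall j, 0 <= a j) ->
  \sum_(j < N) a j `^ s <= (\sum_(j < N) a j) `^ s.
Proof.
move=> s1 a0; elim: N => [|N IH]; first by rewrite !big_ord0 powR_ge0.
rewrite !big_ord_recr/=.
apply: le_trans (ler_powRD s1 _ (a0 N)); last by rewrite sumr_ge0.
by rewrite lerD2r.
Qed.

Lemma lee_poweR_sum (s : R) (N : nat) (a : nat -> \bar R) : 1 <= s ->
  (forall j, 0 <= a j)%E ->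
  (\sum_(j < N) a j `^ s <= (\sum_(j < N) a j) `^ s)%E.
Proof.
move=> s1 a0; have s0 : 0 < s by rewrite (lt_le_trans _ s1).
elim: N => [|N IH]; first by rewrite !big_ord0 poweR_ge0.
rewrite !big_ord_recr/=; set b := (\sum_(i < N) a i)%E.
apply: (@le_trans _ _ (b `^ s + a N `^ s)%E); first by rewrite leeD2r.
have b0 : (0 <= b)%E by rewrite sume_ge0.
move: b b0 (a N) (a0 N) {IH} => [b| |] b0 [c| |] c0//=; rewrite ?addye ?addey ?poweRyr ?gt_eqF// ?leey//.
by rewrite -!EFinD lee_fin ler_powRD.
Qed.

(** Bound [a + b] by twice the maximum; this gives a cruder constant than convexity, but for every
    [s >= 0]. *)
Lemma ler_powRD_convex (s a b : R) : 0 <= s -> 0 <= a -> 0 <= b ->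
  (a + b) `^ s <= 2 `^ s * (a `^ s + b `^ s).
Proof.
move=> s0 a0 b0; have := powR_ge0 a s; have := powR_ge0 b s => bs as_.
apply: (@le_trans _ _ ((2 * Num.max a b) `^ s)).
  apply: ler_powR_base => //; first exact: addr_ge0.
  by rewrite mulrDl mul1r lerD// le_max lexx ?orbT.
rewrite powRM ?le_max ?a0// ler_wpM2l ?powR_ge0//.
by rewrite maxEle; case: ifP => _; rewrite ?lerDl ?lerDr.
Qed.

(** For [a <= b], the portion of [t] between the levels [a] and [b]: 0 below [a], [t - a] in
    between, [b - a] above [b]. *)
Definition slice (a b t : R) : R := Num.min t b - Num.min t a.

Lemma slice_lipschitz a b t t' : a <= b ->
  `|slice a b t - slice a b t'| <= `|t - t'|.
Proof.
wlog tt' : t t' / t <= t' => [H ab|].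
  by have /orP[|] := le_total t t' => h; [|rewrite distrC (distrC t)]; exact: H.
move=> ab; rewrite /slice !minEle ler_norml.
have -> : `|t - t'| = t' - t by rewrite distrC ger0_norm// subr_ge0.
by do !case: ifPn; rewrite -?ltNge => *; apply/andP; split; lra.
Qed.

Lemma slice_nondecreasing a b t t' : a <= b -> t <= t' ->
  slice a b t <= slice a b t'.
Proof.
by move=> ab tt'; rewrite /slice !minEle; do !case: ifPn; rewrite -?ltNge => *; lra.
Qed.

(** For ordered arguments the increments of the slices have the same sign and telescope to at most
    [|t - t'|]; superadditivity of the [p]-th power does the rest. *)
Lemma sum_slice_powR_le (l : nat -> R) (p t t' : R) N : 1 <= p ->
  (forall j, l j <= l j.+1) ->
  \sum_(j < N) `|slice (l j) (l j.+1) t - slice (l j) (l j.+1) t'| `^ p <=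
  `|t - t'| `^ p.
Proof.
move=> p1 l1; wlog tt' : t t' / t' <= t => [H|].
  have /orP[|] := le_total t' t => h; first exact: H.
  rewrite distrC; under eq_bigr do rewrite distrC; exact: H.
apply: le_trans (@ler_powR_sum p N (fun j => `|slice (l j) (l j.+1) t -
  slice (l j) (l j.+1) t'|) p1 (fun=> normr_ge0 _)) _.
apply: ler_powR_base; rewrite ?sumr_ge0// ?(le_trans _ p1)//.
rewrite (eq_bigr (fun j : 'I_N => slice (l j) (l j.+1) t - slice (l j) (l j.+1) t')); last first.
  by move=> j _; rewrite ger0_norm// subr_ge0 slice_nondecreasing.
have sE s : \sum_(j < N) slice (l j) (l j.+1) s = Num.min s (l N) - Num.min s (l 0%N).
  by rewrite -(big_mkord xpredT (fun j => slice (l j) (l j.+1) s)) telescope_sumr.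
rewrite sumrB !sE ger0_norm ?subr_ge0//.
have l0N : l 0%N <= l N by elim: N {sE} => // N /le_trans; apply.
by rewrite !minEle; do !case: ifPn; rewrite -?ltNge => *; lra.
Qed.

(** Take the least [m] with [t < e * 2 ^+ m]. The assumption [2 * e <= t] excludes 0 and 1, and [j]
    is [m - 2]. *)
Lemma dyadic_level (e t : R) : 0 < e -> 2 * e <= t ->
  exists j : nat, e * 2 ^+ j.+1 <= t < 4 * (e * 2 ^+ j).
Proof.
move=> e0 et.
have ex : exists m, t < e * 2 ^+ m.
  exists (Num.truncn (t / e)).+1.
  rewrite mulrC -ltr_pdivrMr//; apply: lt_trans (truncnS_gt _) _.
  by rewrite -natrX ltr_nat ltn_expl.
case: (ex_minnP ex) => -[|[|j]] tm mmin.
- by move: tm; rewrite expr0; lra.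
- by move: tm; rewrite expr1; lra.
exists j; rewrite leNgt; apply/andP; split; last first.
  by move: tm; rewrite !exprS; lra.
by apply/negP => /mmin; rewrite ltnn.
Qed.

End power_sums.

(** * Maz'ya truncation *)

Section mazya_truncation.
Context {R : realType} {n : nat}.
Hypothesis n0 : (0 < n)%N.
Variables (delta tau p q : R) (Omega : set 'rV[R]_n).
Hypotheses (oO : open Omega) (fin : (lebn Omega < +oo)%E).
Hypotheses (p1 : 1 <= p) (pq : p <= q).
Implicit Types (u v : 'rV[R]_n -> R).

Let energy u := (\int[lebn]_(x in Omega) gfun delta tau Omega p u x)%E.

Lemma energy_ge0 u : (0 <= energy u)%E.
Proof. by apply: integral_ge0 => x _; exact: gfun_ge0. Qed.

Lemma energyZ_le (k : R) u : 0 < k ->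
  (energy (fun x => (k * u x)%R) <= (k `^ p)%:E * energy u)%E.
Proof.
move=> k0; have kp0 : 0 < k `^ p by rewrite powR_gt0.
apply: le_trans (ge0_lower_integralZl_le _ kp0 _); last first.
  by move=> x _; exact: gfun_ge0.
apply: ge0_le_lower_integral => x _; first exact: gfun_ge0.
apply: le_trans (ge0_lower_integralZl_le _ kp0 _); last first.
  by move=> y _; rewrite lee_fin divr_ge0 ?powR_ge0.
apply: ge0_le_lower_integral => y _; first by rewrite lee_fin divr_ge0 ?powR_ge0.
rewrite -EFinM lee_fin -mulrBr normrM (gtr0_norm k0) powRM ?normr_ge0 ?(ltW k0)//.
by rewrite mulrA.
Qed.

(** [sum_slice_powR_le] holds at each pair of points; superadditivity of the integral is used first
    in [y], then in [x]. *)
Lemma energy_slices_le (l : nat -> R) v N : (forall j, l j <= l j.+1) ->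
  (\sum_(j < N) energy (fun x => slice (l j) (l j.+1) `|v x|) <= energy v)%E.
Proof.
move=> l1; rewrite /energy.
apply: (@ge0_lower_integral_sum_le _ (Rn R n) R lebn _
  (fun j x => gfun delta tau Omega p (fun x => slice (l j) (l j.+1) `|v x|) x)
  (gfun delta tau Omega p v)).
  by move=> j x _; exact: gfun_ge0.
move=> x _; apply: (@ge0_lower_integral_sum_le _ (Rn R n) R lebn _
  (fun j y => (`|slice (l j) (l j.+1) `|v x| - slice (l j) (l j.+1) `|v y| | `^ p /
    enorm (x - y) `^ (n%:R + p * delta))%:E)
  (fun y => (`|v x - v y| `^ p / enorm (x - y) `^ (n%:R + p * delta))%:E)).
  by move=> j y _; rewrite lee_fin divr_ge0 ?powR_ge0.
move=> y _; rewrite sumEFin lee_fin -mulr_suml ler_wpM2r ?invr_ge0 ?powR_ge0//.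
apply: le_trans (sum_slice_powR_le _ _ _ p1 l1) _.
apply: ler_powR_base; rewrite ?(le_trans _ p1)//.
exact: ler_dist_dist.
Qed.

Lemma mazya_truncation (B : set 'rV[R]_n) :
  capacity_condition delta tau Omega q p B ->
  exists2 K : R, 0 < K & forall v, Cont Omega v -> (forall x, B x -> v x = 0) ->
    (\int[lebn]_(x in Omega) (`|v x| `^ q)%:E <= K%:E * energy v `^ (q / p))%E.
Proof.
move=> [C C0 cap].
have p0 : 0 < p by rewrite (lt_le_trans _ p1).
have q0 : 0 < q by rewrite (lt_le_trans p0).
have s1 : 1 <= q / p by rewrite ler_pdivlMr// mul1r.
have s0 : 0 < q / p by rewrite divr_gt0.
have mO : measurable (Omega : set (Rn R n)) by exact: open_measurable_Rn.
have Ofin : lebn Omega \is a fin_num by rewrite ge0_fin_numE.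
pose o := fine (lebn Omega).
have o0 : 0 <= o by rewrite fine_ge0.
have oE : lebn Omega = o%:E by rewrite fineK.
exists ((4 `^ p * C) `^ (q / p)); first by rewrite powR_gt0// mulr_gt0// powR_gt0.
move=> v vc vB.
have mv : measurable_fun (Omega : set (Rn R n)) (fun x : Rn R n => `|v x|).
  by apply: measurableT_comp => //; exact: Cont_measurable.
(* The levels start at [e]; values of [|v|] below [2 * e] cost at most the extra term, which tends
   to 0 with [e] because [Omega] has finite measure. *)
suff H e : 0 < e -> (\int[lebn]_(x in Omega) (`|v x| `^ q)%:E <=
    ((2 * e) `^ q * o)%R%:E + ((4 `^ p * C) `^ (q / p))%R%:E * energy v `^ (q / p))%E.
  apply/lee_addgt0Pr => eta eta0.
  have o1 : 0 < o + 1 by lra.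
  (* With this choice (2e)^q is [eta / (o + 1)], so the extra term is at most [eta]. *)
  pose e := (eta / (o + 1)) `^ q^-1 / 2.
  have e0 : 0 < e by rewrite divr_gt0// powR_gt0// divr_gt0.
  apply: le_trans (H e e0) _; rewrite addeC leeD2l// lee_fin.
  rewrite /e mulrC [_ / 2]mulrC mulrA divff// mul1r.
  rewrite -powRrM mulVf ?gt_eqF// powRr1 ?divr_ge0 ?(ltW eta0) ?(ltW o1)//.
  by rewrite mulrA ler_pdivrMr// [leRHS]mulrC ler_wpM2r ?ltW//; lra.
move=> e0; pose l j := e * 2 ^+ j.
have l0 j : 0 < l j by rewrite mulr_gt0// exprn_gt0.
have lS j : l j.+1 = 2 * l j by rewrite /l exprS; lra.
have ll j : l j <= l j.+1 by rewrite lS; have := l0 j; lra.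
pose T j x := slice (l j) (l j.+1) `|v x|.
pose A j : set (Rn R n) := Omega `&` [set x | l j.+1 <= `|v x|].
have mA j : measurable (A j).
  rewrite /A (_ : [set x | l j.+1 <= `|v x|] = (fun x : Rn R n => `|v x|) @^-1` `[l j.+1, +oo[).
    by apply: mv => //; exact: measurable_itv.
  by apply/seteqP; split => x; rewrite /= in_itv/= andbT.
(* On [A j] the slice [T j] equals [l j], so [T j / l j] is a test function for [A j]. The factor 4
   is there because a value from [dyadic_level] is below [4 * l j]. *)
have Acap j : (((4 * l j) `^ q)%R%:E * lebn (A j) <=
    ((4 `^ p * C)%R%:E * energy (T j)) `^ (q / p))%E.
  have lp0 : 0 < (l j)^-1 by rewrite invr_gt0.
  have := cap (A j) (mA j) (@subIsetl _ _ _).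
  have -> : A j `&` B = set0.
    apply/seteqP; split => // x [[_ /=] + Bx]; rewrite vB// normr0 leNgt.
    by rewrite l0.
  move=> /(_ erefl) capA.
  have {}capA : (lebn (A j) `^ (p / q) <= (C * (l j)^-1 `^ p)%R%:E * energy (T j))%E.
    apply: le_trans capA _; rewrite EFinM -muleA lee_wpmul2l ?lee_fin ?(ltW C0)//.
    apply: le_trans (@energyZ_le (l j)^-1 (T j) lp0).
    apply: ereal_inf_lbound; exists (fun x => (l j)^-1 * T j x) => //; split.
    - apply: (@Cont_lipschitz _ _ _ oO v _ (l j)^-1 vc) => x y _ _.
      rewrite -mulrBr normrM (gtr0_norm lp0) ler_wpM2l ?(ltW lp0)//.
      exact: le_trans (slice_lipschitz _ _ (ll j)) (ler_dist_dist _ _).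
    - move=> x [_ /= lx]; rewrite /T /slice (min_idPr lx) (min_idPr (le_trans (ll j) lx)).
      by rewrite lS mulrDl mul1r addrK mulVf// gt_eqF.
    - move=> x Bx; rewrite /T vB// normr0 /slice (min_idPl (ltW (l0 _))).
      by rewrite (min_idPl (ltW (l0 _))) subrr mulr0.
  have pqK : p / q * (q / p) = 1 by rewrite mulrA divfK ?gt_eqF// divff ?gt_eqF.
  have l40 : 0 <= 4 * l j by rewrite mulr_ge0 ?(ltW (l0 j)).
  have AE : lebn (A j) = ((lebn (A j) `^ (p / q)) `^ (q / p))%E.
    by rewrite -poweRrM pqK poweRe1.
  rewrite AE (_ : (4 * l j) `^ q = ((4 * l j) `^ p) `^ (q / p)); last first.
    by rewrite -powRrM [p * _]mulrC divfK ?gt_eqF.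
  rewrite -poweR_EFin -poweRM ?lee_fin ?powR_ge0 ?poweR_ge0//.
  apply: ge0_le_poweR; first exact: ltW.
    by rewrite mule_ge0 ?lee_fin ?powR_ge0 ?poweR_ge0.
  apply: (@le_trans _ _ (((4 * l j) `^ p)%R%:E *
      ((C * (l j)^-1 `^ p)%R%:E * energy (T j)))%E).
    by rewrite lee_wpmul2l ?lee_fin ?powR_ge0.
  rewrite muleA -EFinM (_ : (4 * l j) `^ p * (C * (l j)^-1 `^ p) = 4 `^ p * C)//.
  rewrite mulrCA -powRM ?(ltW lp0)// mulrC; congr (_ `^ _ * _).
  by rewrite mulfK// gt_eqF.
pose F j (x : Rn R n) : \bar R := ((4 * l j) `^ q * \1_(A j) x)%R%:E.
have F0 j x : (0 <= F j x)%E by rewrite lee_fin mulr_ge0 ?powR_ge0// indicE.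
have mF j : measurable_fun (Omega : set (Rn R n)) (F j).
  by apply/measurable_EFinP; apply: measurable_funM.
(* Where [|v x|] is at least [2 * e], the single term of the series given by [dyadic_level] already
   dominates. *)
apply: (@le_trans _ _ (\int[lebn]_(x in Omega)
    (((2 * e) `^ q)%R%:E + \sum_(j <oo) F j x))%E).
  apply: ge0_le_lower_integral => x Ox; first by rewrite lee_fin powR_ge0.
  have [ve|ve] := leP (2 * e) `|v x|; last first.
    apply: (@le_trans _ _ ((2 * e) `^ q)%R%:E).
      by rewrite lee_fin ler_powR_base ?(ltW q0) ?(ltW ve).
    by rewrite leeDl// nneseries_ge0.
  have [j /andP[lv vl]] := dyadic_level e0 ve.
  apply: (@le_trans _ _ (F j x)).
    rewrite /F indicE mem_set; last by split.
    by rewrite mulr1 lee_fin ler_powR_base ?(ltW q0) ?(ltW vl).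
  apply: (@le_trans _ _ (\sum_(j <oo) F j x)%E); last first.
    by rewrite leeDr// lee_fin powR_ge0.
  apply: le_trans (nneseries_lim_ge j.+1 _) => //.
  by rewrite big_mkord big_ord_recr/= leeDr// sume_ge0.
rewrite ge0_integralD//; last 3 first.
- by move=> x _; rewrite lee_fin powR_ge0.
- by move=> x _; rewrite nneseries_ge0.
- by apply: ge0_measurable_nneseries => // j.
have -> : (\int[lebn]_(x in Omega) ((2 * e) `^ q)%R%:E =
    ((2 * e) `^ q * o)%R%:E)%E.
  by rewrite integral_cst// EFinM -oE.
rewrite leeD2l//.
rewrite integral_nneseries//.
apply: lime_le; first by apply: is_cvg_nneseries => *; apply: integral_ge0.
apply: nearW => N; rewrite big_mkord.
apply: (@le_trans _ _ (\sum_(j < N) ((4 `^ p * C)%R%:E * energy (T j)) `^ (q / p))%E).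
  apply: lee_sum => j _; apply: le_trans (Acap j).
  rewrite /F (@integralZl_indic _ _ _ lebn Omega mO (fun=> A j))//; last first.
    by rewrite ltNge powR_ge0.
  by rewrite integral_indic// setIidl//; exact: subIsetl.
have pC0 : 0 <= 4 `^ p * C by rewrite mulr_ge0 ?powR_ge0 ?ltW.
(* By [p <= q] the exponent [q / p] is at least 1, so the sum of powers is at most the power of the
   sum, and the energies of the slices can be added. *)
apply: le_trans (@lee_poweR_sum _ _ N (fun j => (4 `^ p * C)%R%:E * energy (T j))%E s1 _) _.
  by move=> j; rewrite mule_ge0 ?energy_ge0.
rewrite -ge0_sume_distrr; last by move=> j _; exact: energy_ge0.
rewrite -poweR_EFin -poweRM ?lee_fin ?energy_ge0//.
apply: ge0_le_poweR; first exact: ltW.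
  by rewrite mule_ge0 ?lee_fin// sume_ge0// => j _; exact: energy_ge0.
rewrite lee_wpmul2l ?lee_fin//.
exact: energy_slices_le.
Qed.

End mazya_truncation.

Lemma powRD_gt0 {R : realType} (x a b : R) : 0 < x ->
  x `^ (a + b) = x `^ a * x `^ b.
Proof. by move=> x0; rewrite powRD// (gt_eqF x0) implybT. Qed.

(** * Integrability of the kernel of a cutoff function *)

Section cutoff_kernel.
Context {R : realType} {n : nat}.
Hypothesis n0 : (0 < n)%N.
Variables (delta p r : R) (Omega : set 'rV[R]_n).
Hypotheses (oO : open Omega) (fin : (lebn Omega < +oo)%E).
Hypotheses (hdelta : 0 < delta < 1) (p1 : 1 <= p) (r0 : 0 < r).

Let s := n%:R + p * delta.

(** The Lipschitz bound serves near the diagonal, where the kernel is singular, the bound by 1 far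
    from it. *)
Definition cutoff (psi : 'rV[R]_n -> R) : Prop :=
  forall x y, `|psi x - psi y| <= 1 /\ `|psi x - psi y| <= enorm (x - y) / r.

Definition cutoff_kernel (psi : 'rV[R]_n -> R) (x y : 'rV[R]_n) : R :=
  `|psi x - psi y| `^ p / enorm (x - y) `^ s.

Lemma cutoff_kernel_ge0 psi x y : 0 <= cutoff_kernel psi x y.
Proof. by rewrite divr_ge0 ?powR_ge0. Qed.

Lemma cutoff_continuous psi : cutoff psi -> continuous psi.
Proof.
move=> cpsi; apply: (@lipschitz_enorm_continuous _ _ _ r^-1) => x y.
by rewrite mulrC; have [] := cpsi x y.
Qed.

Lemma measurable_cutoff_kernel psi x : cutoff psi ->
  measurable_fun (Omega : set (Rn R n)) (fun y : Rn R n => cutoff_kernel psi x y).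
Proof.
move=> cpsi.
rewrite (_ : (fun y => _) = fun y : Rn R n =>
    `|psi x - psi y| `^ p * enorm (y - x) `^ (- s)); last first.
  by apply/funext => y; rewrite powRN enormC.
have cdist : Cont Omega (fun y => psi x - psi y).
  apply: (Cont_lipschitz oO (f := psi) (L := 1)) => [|y z _ _].
    exact/(continuous_Cont oO)/cutoff_continuous.
  by rewrite mul1r [leRHS]distrC opprD opprK addrACA subrr add0r addrC.
have menorm : measurable_fun (Omega : set (Rn R n)) (fun y : Rn R n => enorm (y - x)).
  exact/(Cont_measurable n0 oO)/(continuous_Cont oO)/continuous_enormB.
apply: measurable_funM; first exact: Cont_measurable_powR.
exact: (measurableT_comp (measurable_powR (- s))).
Qed.

Let s0 : 0 < s.
Proof.
have /andP[d0 _] := hdelta.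
by rewrite ltr_wpDl// mulr_gt0// (lt_le_trans _ p1).
Qed.

Let radius (k : nat) : R := r * 2^-1 ^+ k.

Let radius_gt0 k : 0 < radius k.
Proof. by rewrite mulr_gt0// exprn_gt0// invr_gt0. Qed.

(** Bounds the kernel on the annulus [radius k.+1 <= |x - y| < radius k], where [psi] varies by at
    most 2^-k. *)
Let weight (k : nat) : R := (2^-1 ^+ k) `^ p * radius k.+1 `^ (- s).

Let ratio : R := 2^-1 `^ (p * (1 - delta)).

Lemma ratio_lt1 : ratio < 1.
Proof.
have /andP[d0 d1] := hdelta.
have a0 : 0 < p * (1 - delta) by rewrite mulr_gt0 ?subr_gt0// (lt_le_trans _ p1).
have E1 : 1 `^ (p * (1 - delta)) = 1 :> R by rewrite powR1.
rewrite -[ltRHS]E1 gt0_ltr_powR// ?nnegrE ?invr_ge0// invf_lt1//.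
by rewrite ltr1n.
Qed.

Let const : R := 4 ^+ n * (r / 2) `^ (- (p * delta)).

(** The weight times the volume of a cube around the ball of radius [radius k] is the term of a
    geometric series, whose ratio is below 1 because [delta < 1]. *)
Lemma weight_volume k : weight k * (2 * radius k) ^+ n = const * ratio ^+ k.
Proof.
have k20 : (0 : R) < 2^-1 ^+ k by rewrite exprn_gt0// invr_gt0.
have -> : 2 * radius k = 4 * radius k.+1 by rewrite /radius exprS; lra.
have -> : ratio ^+ k = (2^-1 ^+ k) `^ (p * (1 - delta)).
  have h0 : 0 <= 2^-1 :> R by rewrite invr_ge0.
  rewrite -(powR_mulrn k (powR_ge0 _ _)) -(powR_mulrn k h0).
  by rewrite -!powRrM [k%:R * _]mulrC.
rewrite /weight exprMn.
have -> : radius k.+1 `^ (- s) = radius k.+1 `^ (- (p * delta)) / radius k.+1 ^+ n.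
  rewrite -powR_mulrn ?(ltW (radius_gt0 _))// -powRN -powRD_gt0//.
  by rewrite /s opprD addrC.
have -> : radius k.+1 = (r / 2) * 2^-1 ^+ k by rewrite /radius exprS mulrA.
rewrite (_ : p * (1 - delta) = p - p * delta); last by rewrite mulrBr mulr1.
rewrite powRD_gt0// powRM ?(ltW k20)//; last first.
  by rewrite divr_ge0// ltW.
rewrite /const; set a := _ `^ p; set b := _ `^ - _; set c := (_ `^ - _).
set w := (_ ^+ n); have w0 : w != 0.
  by rewrite expf_neq0// mulf_neq0// ?gt_eqF// divr_gt0.
by field.
Qed.

(** Off the diagonal, [k] is the index of the dyadic annulus around [x] that contains [y], found
    from the least [m] with [r <= d * 2 ^+ m]; [m] is not 0 since [d < r]. *)
Lemma cutoff_kernel_near psi x y : cutoff psi -> enorm (x - y) < r ->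
  cutoff_kernel psi x y = 0 \/
  exists2 k, enorm (x - y) < radius k & cutoff_kernel psi x y <= weight k.
Proof.
move=> cpsi dr; have [c1 cr] := cpsi x y.
set d := enorm (x - y) in dr cr *.
have [d0|dn0] := eqVneq d 0.
  left; rewrite /cutoff_kernel -/d; move: cr; rewrite d0 mul0r normr_le0 => /eqP->.
  have pn0 : p != 0 by rewrite gt_eqF// (lt_le_trans _ p1).
  by rewrite normr0 (powR0 pn0) mul0r.
have d0 : 0 < d by rewrite lt_def dn0 enorm_ge0.
right; have ex : exists m, r <= d * 2 ^+ m.
  exists (Num.truncn (r / d)).+1; rewrite mulrC -ler_pdivrMr//.
  apply: ltW; apply: lt_trans (truncnS_gt _) _.
  by rewrite -natrX ltr_nat ltn_expl.
case: (ex_minnP ex) => -[|k] rk kmin; first by move: rk dr; rewrite expr0 mulr1; lra.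
have p20 m : (0 : R) < 2 ^+ m by rewrite exprn_gt0.
have dk : d < radius k.
  rewrite /radius exprVn ltr_pdivlMr// ltNge; apply/negP => /kmin.
  by rewrite ltnn.
exists k => //; rewrite /cutoff_kernel -/d /weight -powRN.
apply: ler_pM; rewrite ?powR_ge0//.
  apply: ler_powR_base; rewrite ?(le_trans _ p1)//.
  apply: le_trans cr _; rewrite ler_pdivrMr// mulrC; exact: ltW.
rewrite !powRN lef_pV2 ?posrE ?powR_gt0//.
apply: ler_powR_base; rewrite ?(ltW s0) ?(ltW (radius_gt0 _))//.
by rewrite /radius exprVn ler_pdivrMr.
Qed.

Lemma cutoff_kernel_far psi x y : cutoff psi -> r <= enorm (x - y) ->
  cutoff_kernel psi x y <= r `^ (- s).
Proof.
move=> cpsi dr; have [c1 _] := cpsi x y.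
rewrite /cutoff_kernel -powRN -[leRHS]mul1r; apply: ler_pM; rewrite ?powR_ge0//.
  have E1 : 1 `^ p = 1 :> R by rewrite powR1.
  by rewrite -[leRHS]E1 ler_powR_base// (le_trans _ p1).
rewrite !powRN lef_pV2 ?posrE ?powR_gt0 ?(lt_le_trans r0)//.
by rewrite ler_powR_base ?(ltW s0) ?(ltW r0).
Qed.

Lemma cutoff_kernel_integral : exists2 K : R, 0 <= K &
  forall psi x (D : set (Rn R n)), cutoff psi -> measurable D -> D `<=` Omega ->
    (\int[lebn]_(y in D) (cutoff_kernel psi x y)%:E <= K%:E)%E.
Proof.
have mO : measurable (Omega : set (Rn R n)) by exact: open_measurable_Rn.
pose o := fine (lebn Omega).
have o0 : 0 <= o by rewrite fine_ge0.
have oE : lebn Omega = o%:E by rewrite fineK// ge0_fin_numE.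
have w0 k : 0 <= weight k by rewrite mulr_ge0 ?powR_ge0.
have c0 : 0 <= const by rewrite mulr_ge0 ?powR_ge0.
have q1 := ratio_lt1; have q0 : 0 <= ratio by rewrite powR_ge0.
have q1' : 0 < 1 - ratio by rewrite subr_gt0.
exists (r `^ (- s) * o + const / (1 - ratio)).
  by rewrite addr_ge0 ?mulr_ge0 ?powR_ge0 ?invr_ge0 ?(ltW q1').
move=> psi x D cpsi mD DO.
pose B k : set (Rn R n) := eball x (radius k).
have mB k : measurable (B k) by exact: measurable_eball.
pose F k (y : Rn R n) : \bar R := (weight k * \1_(B k) y)%R%:E.
have F0 k y : (0 <= F k y)%E by rewrite lee_fin mulr_ge0// indicE.
have mF k : measurable_fun D (F k).
  by apply/measurable_EFinP; apply: measurable_funM.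
apply: (@le_trans _ _ (\int[lebn]_(y in D)
    ((r `^ (- s))%R%:E + \sum_(k <oo) F k y))%E).
  apply: ge0_le_lower_integral => y Dy; first by rewrite lee_fin cutoff_kernel_ge0.
  have S0 : (0 <= \sum_(k <oo) F k y)%E by rewrite nneseries_ge0.
  have [ry|yr] := leP r (enorm (x - y)).
    apply: (@le_trans _ _ (r `^ (- s))%R%:E); last by rewrite leeDl.
    by rewrite lee_fin cutoff_kernel_far.
  have [->|[k yk kw]] := cutoff_kernel_near cpsi yr.
    by rewrite adde_ge0 ?lee_fin ?powR_ge0.
  apply: (@le_trans _ _ (F k y)).
    by rewrite /F indicE mem_set// mulr1 lee_fin.
  apply: (@le_trans _ _ (\sum_(k <oo) F k y)%E); last first.
    by rewrite leeDr// lee_fin powR_ge0.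
  apply: le_trans (nneseries_lim_ge k.+1 _) => //.
  by rewrite big_mkord big_ord_recr/= leeDr// sume_ge0.
have rs0 (y : Rn R n) : D y -> (0 <= (cst (r `^ (- s))%R%:E : Rn R n -> \bar R) y)%E.
  by move=> _; rewrite lee_fin powR_ge0.
have S0 y : D y -> (0 <= \sum_(k <oo) F k y)%E by move=> _; rewrite nneseries_ge0.
have mS : measurable_fun D (fun y => \sum_(k <oo) F k y)%E.
  exact: ge0_measurable_nneseries.
rewrite (ge0_integralD lebn mD rs0 (measurable_cst _) S0 mS).
rewrite EFinD leeD//.
  apply: (@le_trans _ _ ((r `^ (- s))%R%:E * lebn D)%E).
    by rewrite integral_cst.
  rewrite [leRHS]EFinM -oE; apply: lee_wpmul2l; first by rewrite lee_fin powR_ge0.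
  exact: le_lebesgue_outer.
rewrite integral_nneseries//.
apply: lime_le; first by apply: is_cvg_nneseries => *; apply: integral_ge0.
apply: nearW => N; rewrite big_mkord.
apply: (@le_trans _ _ (\sum_(k < N) (const * ratio ^+ k)%:E)%E).
  apply: lee_sum => k _.
  rewrite /F (@integralZl_indic _ _ _ lebn D mD (fun=> B k))//; last first.
    by rewrite ltNge w0.
  rewrite integral_indic// -weight_volume [leRHS]EFinM; apply: lee_wpmul2l; first by rewrite lee_fin.
  apply: le_trans (le_lebesgue_outer (@subIsetl _ _ _)) _.
  exact: (lebn_eball_le n0 x (ltW (radius_gt0 k))).
rewrite sumEFin lee_fin -mulr_sumr ler_wpM2l//.
rewrite -[leRHS]mul1r ler_pdivlMr// mulrC -opprB mulNr -subrX1 opprB.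
by rewrite lerBlDr lerDl exprn_ge0.
Qed.

End cutoff_kernel.

Lemma ge0_lower_integral_subset d (T : measurableType d) (R : realType)
    (mu : {measure set T -> \bar R}) (A D : set T) (f : T -> \bar R) :
  A `<=` D -> (forall x, D x -> (0 <= f x)%E) ->
  (\int[mu]_(x in A) f x <= \int[mu]_(x in D) f x)%E.
Proof.
move=> AD f0; rewrite [leLHS]integral_mkcond [leRHS]integral_mkcond.
apply: ge0_le_lower_integral => x _; rewrite /patch.
  by case: ifPn => //; rewrite inE => /AD /f0.
case: ifPn => [|_]; first by rewrite inE => Ax; rewrite mem_set//; exact: AD.
by case: ifPn => //; rewrite inE => /f0.
Qed.

(** * Energy of a cutoff product, and choice of the constant to subtract *)

Section cutoff_energy.
Context {R : realType} {n : nat}.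
Hypothesis n0 : (0 < n)%N.
Variables (delta tau p r : R) (Omega : set 'rV[R]_n) (x0 : 'rV[R]_n).
Hypotheses (oO : open Omega) (fin : (lebn Omega < +oo)%E).
Hypotheses (hdelta : 0 < delta < 1) (p1 : 1 <= p) (r0 : 0 < r).

Let s := n%:R + p * delta.
Let D : set (Rn R n) := eball x0 (3 * r).
Let energy u := (\int[lebn]_(x in Omega) gfun delta tau Omega p u x)%E.

Hypothesis DO : D `<=` Omega.

Let mO : measurable (Omega : set (Rn R n)).
Proof. exact: open_measurable_Rn. Qed.

Let mD : measurable D.
Proof. exact: measurable_eball. Qed.

Let p0 : 0 < p. Proof. exact: lt_le_trans p1. Qed.

Let s0 : 0 < s.
Proof.
by have /andP[d0 _] := hdelta; rewrite ltr_wpDl// mulr_gt0.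
Qed.

Let measurable_powR_dist u c (A : set (Rn R n)) : Cont Omega u -> A `<=` Omega ->
  measurable A -> measurable_fun A (fun x : Rn R n => `|u x - c| `^ p).
Proof.
move=> uc AO mA; apply: (measurable_funS mO AO).
exact/(Cont_measurable_powR n0 oO)/(ContB_cst oO).
Qed.

Let domain_gfun x : set (Rn R n) :=
  Omega `&` eball x (tau * dist_boundary Omega x).

Let measurable_domain_gfun x : measurable (domain_gfun x).
Proof. by apply: measurableI => //; exact: measurable_eball. Qed.

(* Near the ball the increment of [psi * (u - c)] is split with [u x - c] in
   front of the increment of [psi], which is integrable against the kernel; far
   from it with [u y - c], and there only points [y] at distance at least [r]
   from [x] contribute. *)
Lemma cutoff_energy_le : exists2 K : R, 0 < K &
  forall psi, cutoff r psi -> (forall x, `|psi x| <= 1) ->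
    (forall x y, ~ eball x0 (2 * r) x -> ~ eball x0 (2 * r) y -> psi x = psi y) ->
  forall u c (I : R), Cont Omega u -> 0 <= I ->
    (\int[lebn]_(x in D) (`|u x - c| `^ p)%:E <= I%:E)%E ->
    (energy (fun x => (psi x * (u x - c))%R) <= K%:E * (energy u + I%:E))%E.
Proof.
have [K0 K00 kerK] := @cutoff_kernel_integral _ _ n0 delta p r Omega oO fin hdelta p1 r0.
pose o := fine (lebn Omega).
have o0 : 0 <= o by rewrite fine_ge0.
have oE : lebn Omega = o%:E by rewrite fineK// ge0_fin_numE.
pose M := r `^ (- s); have M0 : 0 <= M by rewrite powR_ge0.
have t0 : (0 : R) < 2 `^ p by rewrite powR_gt0.
(* 2^p pays for splitting each increment in two, [K0] bounds the integrated kernel for [x] in [D],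
   and [M * o] collects the points [x] outside [D]. *)
exists (2 `^ p * (1 + K0 + M * o)).
  by rewrite mulr_gt0// -addrA ltr_wpDr// addr_ge0// mulr_ge0.
move=> psi cpsi psi1 psiout u c I uc I0 uI.
set v := fun x => _.
have E0 : (0 <= energy u)%E by apply: integral_ge0 => x _; exact: gfun_ge0.
have a0 x : 0 <= `|u x - c| `^ p by exact: powR_ge0.
have term_le (A a b k : R) : A <= a + b -> 0 <= A -> 0 <= a -> 0 <= b ->
    A `^ p / k `^ s <= 2 `^ p * (a `^ p / k `^ s) + 2 `^ p * (b `^ p / k `^ s).
  move=> Aab A0' a0' b0'; rewrite -mulrDr -mulrDl mulrA.
  rewrite ler_wpM2r ?invr_ge0 ?powR_ge0//.
  apply: (@le_trans _ _ ((a + b) `^ p)); first by rewrite ler_powR_base// ltW.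
  by rewrite ler_powRD_convex// ltW.
have gu_le x : (\int[lebn]_(y in domain_gfun x)
    ((2 `^ p)%R%:E * (`|u x - u y| `^ p / enorm (x - y) `^ s)%R%:E) <=
    (2 `^ p)%R%:E * gfun delta tau Omega p u x)%E.
  apply: (@ge0_lower_integralZl_le _ (Rn R n) R lebn (domain_gfun x) _
    (fun y => (`|u x - u y| `^ p / enorm (x - y) `^ s)%R%:E) t0) => y _.
  by rewrite lee_fin divr_ge0 ?powR_ge0.
have mker x : measurable_fun (domain_gfun x)
    (fun y : Rn R n => cutoff_kernel delta p psi x y).
  apply: (measurable_funS mO); first exact: subIsetl.
  exact: (measurable_cutoff_kernel n0 delta p oO x cpsi).
have mh1 : measurable_fun (Omega : set (Rn R n))
    (fun x : Rn R n => `|u x - c| `^ p * \1_D x).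
  apply: (@measurable_funM _ _ _ _ (fun x : Rn R n => `|u x - c| `^ p) \1_D).
    exact: measurable_powR_dist.
  exact: (measurable_funS measurableT (@subsetT _ _) (measurable_indic mD)).
have near x : D x -> (gfun delta tau Omega p v x <=
    (2 `^ p)%R%:E * gfun delta tau Omega p u x +
    (2 `^ p * (K0 * `|u x - c| `^ p))%R%:E)%E.
  move=> Dx; apply: le_trans (@ge0_lower_integral_leD _ (Rn R n) R lebn
    (domain_gfun x) (measurable_domain_gfun x) _
    (fun y => ((2 `^ p)%R%:E * (`|u x - u y| `^ p / enorm (x - y) `^ s)%R%:E)%E)
    (fun y => (2 `^ p * `|u x - c| `^ p) * cutoff_kernel delta p psi x y) _ _ _ _ _) _.
  - by move=> y _; rewrite lee_fin divr_ge0 ?powR_ge0.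
  - move=> y _; apply: mule_ge0; rewrite lee_fin; [exact: powR_ge0|].
    by rewrite divr_ge0 ?powR_ge0.
  - by move=> y _; apply: mulr_ge0; [rewrite mulr_ge0 ?powR_ge0|exact: cutoff_kernel_ge0].
  - by apply: measurable_funM => //; exact: mker.
  - move=> y _; rewrite -EFinM -EFinD lee_fin.
    apply: le_trans (term_le _ `|u x - u y| (`|u x - c| * `|psi x - psi y|) _ _ _ _ _) _ => //.
      have -> : v x - v y = psi y * (u x - u y) + (u x - c) * (psi x - psi y).
        by rewrite /v; ring.
      apply: le_trans (ler_normD _ _) _; rewrite !normrM lerD2r.
      by rewrite ler_piMl.
    by rewrite lerD2l /cutoff_kernel powRM// !mulrA.
  apply: leeD; first exact: gu_le.
  under eq_integral do rewrite EFinM.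
  have ker0 y : domain_gfun x y -> (0 <= (cutoff_kernel delta p psi x y)%:E)%E.
    by move=> _; rewrite lee_fin cutoff_kernel_ge0.
  have k0 : 0 <= 2 `^ p * `|u x - c| `^ p by rewrite mulr_ge0 ?powR_ge0.
  have /measurable_EFinP mk := mker x.
  rewrite (ge0_integralZl_EFin lebn (measurable_domain_gfun x) ker0 mk k0).
  rewrite mulrCA [leRHS]EFinM muleC; apply: lee_wpmul2r.
    by rewrite lee_fin mulr_ge0 ?powR_ge0.
  by apply: kerK => //; exact: subIsetl.
have far x : Omega x -> ~ D x -> (gfun delta tau Omega p v x <=
    (2 `^ p)%R%:E * gfun delta tau Omega p u x + (2 `^ p * (M * I))%R%:E)%E.
  move=> Ox nDx.
  have nx : ~ eball x0 (2 * r) x.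
    by move=> x2; apply: nDx; apply: lt_trans x2 _; rewrite ltr_pM2r// ltr_nat.
  have mh : measurable_fun (domain_gfun x) (fun y : Rn R n =>
      (2 `^ p * M) * (`|u y - c| `^ p * \1_D y)).
    apply: (@measurable_funM _ _ _ _ (cst (2 `^ p * M))); first exact: measurable_cst.
    exact: (measurable_funS mO (@subIsetl _ _ _) mh1).
  apply: le_trans (@ge0_lower_integral_leD _ (Rn R n) R lebn
    (domain_gfun x) (measurable_domain_gfun x) _
    (fun y => ((2 `^ p)%R%:E * (`|u x - u y| `^ p / enorm (x - y) `^ s)%R%:E)%E)
    (fun y => (2 `^ p * M) * (`|u y - c| `^ p * \1_D y)) _ _ _ _ _) _ => //.
  - by move=> y _; rewrite lee_fin divr_ge0 ?powR_ge0.
  - move=> y _; apply: mule_ge0; rewrite lee_fin; [exact: powR_ge0|].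
    by rewrite divr_ge0 ?powR_ge0.
  - by move=> y _; rewrite !mulr_ge0 ?powR_ge0// indicE.
  - move=> y _; rewrite -EFinM -EFinD lee_fin.
    apply: le_trans (term_le _ `|u x - u y| (`|u y - c| * `|psi x - psi y|) _ _ _ _ _) _ => //.
      have -> : v x - v y = psi x * (u x - u y) + (u y - c) * (psi x - psi y).
        by rewrite /v; ring.
      apply: le_trans (ler_normD _ _) _; rewrite !normrM lerD2r.
      by rewrite ler_piMl.
    rewrite lerD2l -mulrA ler_pM2l// powRM// -mulrA.
    (* If [y] is also outside B(x0, 2r), then [psi x = psi y]; otherwise [|x - y| >= r] because [x]
       is outside B(x0, 3r). *)
    have [y2|ny2] := pselect (eball x0 (2 * r) y).
      have Dy : D y by apply: lt_trans y2 _; rewrite ltr_pM2r// ltr_nat.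
      rewrite indicE mem_set// mulr1 mulrC ler_wpM2r//.
      apply: (@cutoff_kernel_far _ _ delta p r hdelta p1 r0) => //.
      rewrite leNgt; apply/negP => xy; apply: nDx.
      apply: le_lt_trans (ler_enormB y _ _) _; rewrite enormC in xy.
      have -> : 3 * r = 2 * r + r by ring.
      exact: ltrD.
    rewrite (psiout x y)// subrr normr0 powR0 ?gt_eqF// mul0r mulr0.
    by rewrite !mulr_ge0// indicE.
  apply: leeD; first exact: gu_le.
  rewrite mulrA [leRHS]EFinM; under eq_integral do rewrite EFinM.
  have D0 y : domain_gfun x y -> (0 <= (`|u y - c| `^ p * \1_D y)%R%:E)%E.
    by move=> _; rewrite lee_fin mulr_ge0// indicE.
  have k0 : 0 <= 2 `^ p * M by rewrite mulr_ge0 ?powR_ge0.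
  have mk : measurable_fun (domain_gfun x)
      (fun y : Rn R n => (`|u y - c| `^ p * \1_D y)%R%:E).
    by apply/measurable_EFinP; exact: (measurable_funS mO (@subIsetl _ _ _) mh1).
  rewrite (ge0_integralZl_EFin lebn (measurable_domain_gfun x) D0 mk k0).
  apply: lee_wpmul2l; first by rewrite lee_fin mulr_ge0 ?powR_ge0.
  apply: le_trans _ uI; rewrite [leLHS]integral_mkcond [leRHS]integral_mkcond.
  apply: ge0_le_lower_integral => y _; rewrite /patch.
    by case: ifPn => // _; rewrite lee_fin mulr_ge0// indicE.
  rewrite indicE; case: (boolP (y \in D)) => [yD|_].
    by case: ifPn => _; rewrite ?mulr1// lee_fin.
  by case: ifPn => _ //; rewrite mulr0.
(* The error terms of both regions together form one measurable function, as
   [ge0_lower_integral_leD] requires of one of the summands. *)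
pose h (x : Rn R n) : R := 2 `^ p * (K0 * (`|u x - c| `^ p * \1_D x)) + 2 `^ p * (M * I).
have mh : measurable_fun (Omega : set (Rn R n)) h.
  apply: measurable_funD; last exact: measurable_cst.
  apply: (@measurable_funM _ _ _ _ (cst (2 `^ p))); first exact: measurable_cst.
  by apply: (@measurable_funM _ _ _ _ (cst K0)); first exact: measurable_cst.
have i0 x : 0 <= `|u x - c| `^ p * \1_D x by rewrite mulr_ge0// indicE.
have h0 x : 0 <= h x by rewrite addr_ge0// !mulr_ge0// ltW.
apply: (@le_trans _ _ (\int[lebn]_(x in Omega)
   ((2 `^ p)%R%:E * gfun delta tau Omega p u x) + \int[lebn]_(x in Omega) (h x)%:E)%E).
  apply: (@ge0_lower_integral_leD _ (Rn R n) R lebn) => //.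
  - by move=> x _; exact: gfun_ge0.
  - by move=> x _; rewrite mule_ge0 ?gfun_ge0// lee_fin ltW.
  move=> x Ox; have [Dx|nDx] := pselect (D x).
    apply: le_trans (near x Dx) _; rewrite leeD2l// lee_fin /h indicE mem_set// mulr1.
    by rewrite lerDl !mulr_ge0// ltW.
  apply: le_trans (far x Ox nDx) _; rewrite leeD2l// lee_fin /h.
  by rewrite lerDr !mulr_ge0// ltW.
have gE : (\int[lebn]_(x in Omega) ((2 `^ p)%R%:E * gfun delta tau Omega p u x) <=
    (2 `^ p)%R%:E * energy u)%E.
  by apply: ge0_lower_integralZl_le => // x _; exact: gfun_ge0.
have hE : (\int[lebn]_(x in Omega) (h x)%:E <= (2 `^ p * (K0 + M * o) * I)%R%:E)%E.
  pose h1 (x : Rn R n) : \bar R := (`|u x - c| `^ p * \1_D x)%R%:E.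
  have h10 x : Omega x -> (0 <= h1 x)%E by move=> _; rewrite lee_fin.
  have mh1' : measurable_fun (Omega : set (Rn R n)) h1 by exact/measurable_EFinP.
  have k0 : 0 <= 2 `^ p * K0 by rewrite mulr_ge0// ltW.
  have e0 : 0 <= 2 `^ p * (M * I) by rewrite !mulr_ge0// ltW.
  rewrite (eq_integral (fun x => (2 `^ p * K0)%R%:E * h1 x +
      (cst (2 `^ p * (M * I))%R%:E) x)%E); last first.
    by move=> x _; rewrite /h1 -EFinM -EFinD /h mulrA.
  rewrite (ge0_integralD lebn mO) => [|x Ox|||]; last 4 first.
  - by rewrite mule_ge0 ?h10.
  - apply: (@emeasurable_funM _ _ _ _ (cst (2 `^ p * K0)%R%:E)) => //.
  - by move=> x _; rewrite lee_fin.
  - exact: measurable_cst.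
  rewrite (ge0_integralZl_EFin lebn mO h10 mh1' k0).
  apply: (@le_trans _ _ ((2 `^ p * K0)%R%:E * I%:E + (2 `^ p * (M * I) * o)%R%:E)%E).
    apply: leeD; last by rewrite integral_cst// [leRHS]EFinM -oE.
    apply: lee_wpmul2l; first by rewrite lee_fin.
    apply: le_trans _ uI; rewrite [leLHS]integral_mkcond [leRHS]integral_mkcond.
    apply: ge0_le_lower_integral => x _; rewrite /patch.
      by case: ifPn => // _; rewrite lee_fin.
    rewrite /h1 indicE; case: (boolP (x \in D)) => [xD|_].
      by case: ifPn => _; rewrite ?mulr1// lee_fin.
    by case: ifPn => _ //; rewrite mulr0.
  by rewrite -EFinM -EFinD lee_fin; lra.
apply: (le_trans (leeD gE hE)).
rewrite [leRHS]ge0_muleDr ?lee_fin//.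
apply: leeD.
  apply: lee_wpmul2r => //; rewrite lee_fin ler_peMr ?(ltW t0)//.
  by rewrite -addrA lerDl addr_ge0// mulr_ge0.
rewrite -EFinM lee_fin ler_wpM2r// ler_pM2l// -addrA lerDr//.
Qed.

(** By Chebyshev's inequality g_u is at most [e / b] at some [y] of [D]. Two points of [D] are less
    than [6 * r] apart, so [D] lies in the domain of integration of g_u(y), and the kernel there is
    at least (6r)^(-s). *)
Lemma exists_good_value u (e : R) : (0 < tau) ->
  (forall x, D x -> 6 * r <= tau * dist_boundary Omega x) ->
  (energy u < e%:E)%E ->
  exists2 y, D y & (\int[lebn]_(x in D) (`|u x - u y| `^ p)%:E <=
    ((6 * r) `^ s / fine (lebn D) * e)%R%:E)%E.
Proof.
move=> tau0 Dtau Ee.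
have b0 : (0 < lebn D)%E by apply: lebn_eball_gt0; rewrite // mulr_gt0.
have bfin : lebn D \is a fin_num.
  by rewrite ge0_fin_numE// (le_lt_trans (le_lebesgue_outer DO)).
set b := fine (lebn D).
have bE : lebn D = b%:E by rewrite fineK.
have {}b0 : 0 < b by rewrite -lte_fin -bE.
have E0 : (0 <= energy u)%E by apply: integral_ge0 => x _; exact: gfun_ge0.
have e0 : 0 < e by rewrite -lte_fin (le_lt_trans E0).
have [y Dy gy] : exists2 y, D y & (gfun delta tau Omega p u y <= (e / b)%R%:E)%E.
  apply: contrapT => h.
  have big y : D y -> ((e / b)%R%:E <= gfun delta tau Omega p u y)%E.
    move=> Dy; rewrite leNgt; apply/negP => lt; apply: h; exists y => //; exact: ltW.
  have eb0 : 0 <= e / b by rewrite divr_ge0 ?ltW.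
  have H : ((e / b)%R%:E * lebn D <= energy u)%E.
    apply: ge0_lower_markov => // x _; exact: gfun_ge0.
  by move: H; rewrite bE -EFinM divfK ?gt_eqF// leNgt Ee.
exists y => //; have r6 : 0 < (6 * r) `^ s by rewrite powR_gt0// mulr_gt0.
apply: (@le_trans _ _ (\int[lebn]_(x in D)
  (((6 * r) `^ s)%R%:E * (`|u y - u x| `^ p / enorm (y - x) `^ s)%R%:E))%E).
  apply: ge0_le_lower_integral => x Dx; first by rewrite lee_fin powR_ge0.
  rewrite -EFinM lee_fin distrC.
  have [->|xy] := eqVneq (u y) (u x).
    by rewrite subrr normr0 powR0 ?gt_eqF// mul0r mulr0.
  have [yx|yx] := eqVneq (enorm (y - x)) 0.
    case/negP: xy; apply/eqP; congr u; apply/rowP => i; apply/eqP.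
    rewrite -subr_eq0 -normr_le0 -yx; have := le_coord_enorm (y - x) i.
    by rewrite !mxE.
  rewrite mulrCA ler_peMr ?powR_ge0// ler_pdivlMr ?mul1r; last first.
    by rewrite powR_gt0// lt_def yx enorm_ge0.
  apply: ler_powR_base; rewrite ?enorm_ge0 ?(ltW s0)//.
  apply: le_trans (ler_enormB x0 _ _) _; rewrite enormC.
  have -> : 6 * r = 3 * r + 3 * r by ring.
  by rewrite lerD// ltW.
apply: le_trans (@ge0_lower_integralZl_le _ (Rn R n) R lebn D _
    (fun x => (`|u y - u x| `^ p / enorm (y - x) `^ s)%R%:E) r6 _) _.
  by move=> x _; rewrite lee_fin divr_ge0 ?powR_ge0.
rewrite -mulrA EFinM; apply: lee_wpmul2l; first by rewrite lee_fin ltW.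
rewrite mulrC; apply: le_trans _ gy; apply: ge0_lower_integral_subset.
  move=> x Dx; split; first exact: DO.
  apply: lt_le_trans (Dtau y Dy).
  apply: le_lt_trans (ler_enormB x0 _ _) _; rewrite enormC.
  have -> : 6 * r = 3 * r + 3 * r by ring.
  by rewrite ltrD.
by move=> x _; rewrite lee_fin divr_ge0 ?powR_ge0.
Qed.

End cutoff_energy.

(** * Replacing an arbitrary constant by the mean *)

Section oscillation_about_mean.
Context {R : realType} {n : nat}.
Hypothesis n0 : (0 < n)%N.
Variables (q : R) (Omega : set 'rV[R]_n).
Hypotheses (oO : open Omega) (fin : (lebn Omega < +oo)%E) (q1 : 1 <= q).

(** By the triangle inequality only [|mean Omega u - c|] has to be bounded. It is at most the
    average of [|u - c|], hence at most [2 * t], where t^q = X / |Omega|. *)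
Lemma mean_oscillation_le u c (X : R) :
  Cont Omega u -> (0 < lebn Omega)%E -> 0 < X ->
  (\int[lebn]_(x in Omega) (`|u x - c| `^ q)%:E <= X%:E)%E ->
  (\int[lebn]_(x in Omega) (`|u x - mean Omega u| `^ q)%:E <=
    (2 `^ q * (1 + 2 `^ q) * X)%R%:E)%E.
Proof.
move=> uc O0 X0 uX.
have q0 : 0 < q by exact: lt_le_trans q1.
have mO : measurable (Omega : set (Rn R n)) by exact: open_measurable_Rn.
pose o := fine (lebn Omega).
have oE : lebn Omega = o%:E by rewrite fineK// ge0_fin_numE.
have o0 : 0 < o by rewrite -lte_fin -oE.
have icst (k : R) : (\int[lebn]_(x in Omega) k%:E = (k * o)%:E)%E.
  by rewrite integral_cst// EFinM -oE.
pose t := (X / o) `^ q^-1.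
have Xo : 0 < X / o by rewrite divr_gt0.
have t0 : 0 < t by rewrite powR_gt0.
have tq : t `^ q = X / o by rewrite -powRrM mulVf ?gt_eqF// powRr1 ?ltW.
have mu : measurable_fun (Omega : set (Rn R n)) (u : Rn R n -> R) by exact: Cont_measurable.
have muc : measurable_fun (Omega : set (Rn R n)) (fun x : Rn R n => u x - c).
  by apply: measurable_funB.
have mq : measurable_fun (Omega : set (Rn R n)) (fun x : Rn R n => `|u x - c| `^ q).
  exact/(Cont_measurable_powR n0 oO)/(ContB_cst oO).
(* A pointwise substitute for Hölder's inequality: if [a > t], then a <= t (a/t)^q, and t^q is
   [X / o]. *)
have young (a : R) : 0 <= a -> a <= t + t / (X / o) * a `^ q.
  move=> a0; have [ta|ta] := leP a t.
    by apply: (le_trans ta); rewrite lerDl mulr_ge0 ?powR_ge0// ltW// divr_gt0.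
  apply: (@le_trans _ _ (t / (X / o) * a `^ q)); last by rewrite lerDr ltW.
  have a0' : 0 < a by apply: lt_trans ta.
  rewrite mulrAC ler_pdivlMr// -tq.
  rewrite -(mulr_powRB1 a0 q0) -(mulr_powRB1 (ltW t0) q0) mulrCA.
  rewrite ler_pM2l// ler_pM2l// ler_powR_base ?(ltW t0) ?(ltW ta)// subr_ge0//.
have int1 : (\int[lebn]_(x in Omega) `|u x - c|%:E <= (2 * t * o)%:E)%E.
  have k0 : 0 <= t / (X / o) by rewrite ltW// divr_gt0.
  apply: (@le_trans _ _ (\int[lebn]_(x in Omega) t%:E +
      (t / (X / o))%:E * \int[lebn]_(x in Omega) (`|u x - c| `^ q)%:E)%E).
    rewrite -(ge0_integralZl_EFin lebn mO _ _ k0); last 2 first.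
    - by move=> x _; rewrite lee_fin powR_ge0.
    - exact/measurable_EFinP.
    under [X in (_ <= _ + X)%E]eq_integral do rewrite -EFinM.
    apply: (@ge0_lower_integral_leD _ (Rn R n) R lebn Omega mO _ (cst t%:E)
      (fun x => t / (X / o) * `|u x - c| `^ q)).
    - by move=> x _; rewrite lee_fin.
    - by move=> x _; rewrite lee_fin ltW.
    - by move=> x _; rewrite mulr_ge0 ?powR_ge0.
    - by apply: (@measurable_funM _ _ _ _ (cst (t / (X / o)))) => //; exact: measurable_cst.
    - by move=> x _; rewrite -EFinD lee_fin young.
  apply: (@le_trans _ _ ((t * o)%:E + (t / (X / o))%:E * X%:E)%E).
    rewrite icst leeD2l//; apply: lee_wpmul2l => //; by rewrite lee_fin.
  rewrite -EFinM -EFinD lee_fin le_eqVlt; apply/orP; left; apply/eqP.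
  by field; rewrite !gt_eqF.
(* Integrability makes the mean of [u] a genuine average, for which linearity may be used. *)
have ucint : lebn.-integrable (Omega : set (Rn R n)) (EFin \o (fun x => u x - c)).
  apply/integrableP; split; first exact/measurable_EFinP.
  by apply: (le_lt_trans int1); rewrite ltry.
have cint : lebn.-integrable (Omega : set (Rn R n)) (EFin \o cst c).
  apply/integrableP; split; first by apply/measurable_EFinP; exact: measurable_cst.
  by rewrite /= icst ltry.
have mE : mean Omega u - c = o^-1 * \int[lebn]_(x in Omega) (u x - c).
  have -> : mean Omega u = o^-1 * \int[lebn]_(x in Omega) ((u x - c) + (cst c) x).
    by congr (_ * _); apply: eq_Rintegral => x _; rewrite subrK.
  rewrite RintegralD// mulrDr.
  have -> : \int[lebn]_(x in Omega) (cst c) x = c * o by rewrite Rintegral_cst.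
  by rewrite [c * o]mulrC mulKf ?gt_eqF// addrK.
have mc : `|mean Omega u - c| <= 2 * t.
  rewrite mE normrM gtr0_norm ?invr_gt0// mulrC ler_pdivrMr//.
  apply: (le_trans (le_normr_Rintegral mO ucint)).
  rewrite -lee_fin /Rintegral fineK// ge0_fin_numE; last by apply: integral_ge0.
  by apply: (le_lt_trans int1); rewrite ltry.
have tO : (2 `^ q * (2 * t) `^ q) * o = 2 `^ q * 2 `^ q * X.
  by rewrite powRM ?(ltW t0)// tq; field; rewrite gt_eqF.
have k0 : 0 <= 2 `^ q :> R by rewrite powR_ge0.
apply: (@le_trans _ _ ((2 `^ q)%R%:E * \int[lebn]_(x in Omega) (`|u x - c| `^ q)%:E +
   \int[lebn]_(x in Omega) (2 `^ q * (2 * t) `^ q)%R%:E)%E).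
  rewrite -(ge0_integralZl_EFin lebn mO _ _ k0); last 2 first.
  - by move=> x _; rewrite lee_fin powR_ge0.
  - exact/measurable_EFinP.
  apply: (@ge0_lower_integral_leD _ (Rn R n) R lebn Omega mO _ _
    (cst (2 `^ q * (2 * t) `^ q))).
  - by move=> x _; rewrite lee_fin powR_ge0.
  - by move=> x _; rewrite mule_ge0// lee_fin powR_ge0.
  - by move=> x _; rewrite mulr_ge0 ?powR_ge0.
  - exact: measurable_cst.
  - move=> x _; rewrite -EFinM -EFinD lee_fin -mulrDr.
    apply: (@le_trans _ _ ((`|u x - c| + 2 * t) `^ q)).
      apply: ler_powR_base; rewrite ?(ltW q0)//.
      apply: (le_trans (ler_distD c _ _)); rewrite lerD2l distrC//.
    by apply: ler_powRD_convex; rewrite ?(ltW q0)// mulr_ge0// ltW.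
rewrite icst tO; apply: (@le_trans _ _ ((2 `^ q)%R%:E * X%:E + (2 `^ q * 2 `^ q * X)%R%:E)%E).
  by rewrite leeD2r//; apply: lee_wpmul2l => //; rewrite lee_fin.
by rewrite -EFinM -EFinD lee_fin; lra.
Qed.

End oscillation_about_mean.

(** * The radial cutoff function *)

Section radial_cutoff.
Context {R : realType} {n : nat}.
Variables (x0 : 'rV[R]_n) (r : R).
Hypothesis r0 : 0 < r.

(** Between the spheres of radii [r] and [2 * r] it is affine in the distance to [x0], with slope
    1/r, as [cutoff r] demands. *)
Definition radial_cutoff (x : 'rV[R]_n) : R :=
  Num.min 1 (Num.max 0 (enorm (x - x0) / r - 1)).

Lemma radial_cutoff_itv x : 0 <= radial_cutoff x <= 1.
Proof. by rewrite /radial_cutoff le_min ler01 le_max lexx ge_min lexx. Qed.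

Lemma radial_cutoff_in x : eball x0 r x -> radial_cutoff x = 0.
Proof.
rewrite /eball /= enormC => xr; rewrite /radial_cutoff (max_idPl _) ?(min_idPr _)//.
by rewrite subr_le0 ler_pdivrMr// mul1r ltW.
Qed.

Lemma radial_cutoff_out x : ~ eball x0 (2 * r) x -> radial_cutoff x = 1.
Proof.
move=> /negP; rewrite /eball /= -leNgt enormC => xr.
have xr2 : 2 <= enorm (x - x0) / r by rewrite ler_pdivlMr.
by rewrite /radial_cutoff (min_idPl _)// le_max; apply/orP; right; lra.
Qed.

Lemma cutoff_radial : cutoff r radial_cutoff.
Proof.
move=> x y; split.
  have /andP[x_ge0 x_le1] := radial_cutoff_itv x.
  have /andP[y_ge0 y_le1] := radial_cutoff_itv y.
  by rewrite ler_norml; apply/andP; split; lra.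
apply: (@le_trans _ _ `|enorm (x - x0) / r - enorm (y - x0) / r|).
  rewrite /radial_cutoff !minEle !maxEle.
  have [h|h] := leP (enorm (x - x0) / r) (enorm (y - x0) / r).
    rewrite distrC [leRHS]distrC [leRHS]ger0_norm ?subr_ge0// ler_norml.
    by do !case: ifPn; rewrite -?ltNge => *; apply/andP; split; lra.
  rewrite [leRHS]gtr0_norm ?subr_gt0// ler_norml.
  by do !case: ifPn; rewrite -?ltNge => *; apply/andP; split; lra.
rewrite -mulrBl normrM [`|r^-1|]gtr0_norm ?invr_gt0// ler_wpM2r ?invr_ge0 ?(ltW r0)//.
have h (a b : 'rV[R]_n) : enorm (a - x0) - enorm (b - x0) <= enorm (a - b).
  by rewrite lerBlDr ler_enormB.
by rewrite ler_norml lerNl opprB (enormC x y) h -(enormC x y) h.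
Qed.

End radial_cutoff.

Lemma enormZ_delta {R : realType} {n : nat} (a : R) (i : 'I_n) :
  0 <= a -> enorm (a *: delta_mx 0 i : 'rV[R]_n) = a.
Proof.
move=> a0; rewrite /enorm (bigD1 i)//= big1 => [|j ji].
  by rewrite !mxE !eqxx mulr1 addr0 sqrtr_sqr ger0_norm.
by rewrite !mxE (negPf ji) andbF mulr0 expr0n.
Qed.

(* Limits from above are needed since [exists_good_value] asks for a strict
   upper bound of the energy. *)
Lemma lee_powR_right {R : realType} (X E : \bar R) (K s : R) :
  0 < s -> 0 < K -> (0 <= E)%E ->
  (forall e, (E < e%:E)%E -> (X <= (K * e `^ s)%R%:E)%E) ->
  (X <= (K * 2 `^ s)%R%:E * E `^ s)%E.
Proof.
move=> s0 K0 E0 H; have K2 : 0 < K * 2 `^ s by rewrite mulr_gt0// powR_gt0.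
move: E E0 H => [E| |]//; last first.
  by move=> _ _; rewrite poweRyr ?gt_eqF// gt0_muley ?lte_fin// leey.
(* For [E = 0] no multiple of [E] lies above it, so [e] is chosen with K e^s = eta and [eta] tends
   to 0; for [E > 0] take [e = 2 * E]. *)
rewrite lee_fin le_eqVlt => /predU1P[<-|E0] H.
  rewrite poweR0r ?gt_eqF// mule0; apply/lee_addgt0Pr => eta eta0.
  rewrite add0e; pose e := (eta / K) `^ s^-1.
  have e0 : 0 < e by rewrite powR_gt0// divr_gt0.
  apply: le_trans (H e _) _; first by rewrite lte_fin.
  rewrite lee_fin /e -powRrM mulVf ?gt_eqF// powRr1 ?divr_ge0 ?(ltW eta0) ?(ltW K0)//.
  by rewrite mulrC divfK ?gt_eqF.
have := H (2 * E); rewrite lte_fin => /(_ _)/le_trans; apply; first by lra.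
by rewrite poweR_EFin -EFinM lee_fin powRM ?(ltW E0)// mulrA.
Qed.

(** * From the capacity condition to the Sobolev-Poincaré inequality *)

Section sobolev_of_capacity.
Context {R : realType} {n : nat}.
Hypothesis n0 : (0 < n)%N.
Variables (delta tau p q : R) (Omega : set 'rV[R]_n).
Hypotheses (hO : domain Omega) (fin : (lebn Omega < +oo)%E).
Hypotheses (hdelta : 0 < delta < 1) (tau0 : 0 < tau) (p1 : 1 <= p) (pq : p <= q).

Lemma capacity_sobolev :
  (forall (c : 'rV[R]_n) (r : R), 0 < r -> eball c r `<=` Omega ->
    capacity_condition delta tau Omega q p (eball c r)) ->
  fractional_sobolev_poincare delta tau Omega q p.
Proof.
move=> cap; have [oO _ [x0 Ox0]] := hO.
have p0 : 0 < p by exact: lt_le_trans p1.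
have q1 : 1 <= q by exact: le_trans pq.
have q0 : 0 < q by exact: lt_le_trans q1.
have s0 : 0 < q / p by rewrite divr_gt0.
have mO : measurable (Omega : set (Rn R n)) by exact: open_measurable_Rn.
have bd : boundary Omega !=set0.
  by apply: (boundary_nonempty n0 oO) => //; exists x0.
have [rho rho0 BO] : exists2 rho, 0 < rho & eball x0 (2 * rho) `<=` Omega.
  have /nbhs_ballP[e /= e0 eO] : nbhs x0 Omega by exact: open_nbhs_nbhs.
  exists (e / 2); first by rewrite divr_gt0.
  rewrite mulrC divfK// => y xy; apply: eO; split => // i j.
  rewrite (ord1 i) /ball/=; apply: le_lt_trans xy.
  by apply: le_trans (le_coord_enorm _ j); rewrite !mxE.
(* [3 * r <= rho] keeps B(x0, 3r) at distance at least [rho] from the boundary; [6 * r <= tau * rho]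
   then gives the hypothesis of [exists_good_value]. *)
pose r := Num.min (rho / 3) (tau * rho / 6).
have r0 : 0 < r by rewrite lt_min !divr_gt0// mulr_gt0.
have r3 : 3 * r <= rho by rewrite mulrC -ler_pdivlMr// /r ge_min lexx.
have r6 : 6 * r <= tau * rho by rewrite mulrC -ler_pdivlMr// /r ge_min lexx orbT.
have Drho x : eball x0 (3 * r) x -> eball x0 rho x.
  by move=> /lt_le_trans; apply.
have DO : eball x0 (3 * r) `<=` Omega.
  by move=> x /Drho xr; apply: BO; apply: lt_le_trans xr _; lra.
have Dtau x : eball x0 (3 * r) x -> 6 * r <= tau * dist_boundary Omega x.
  move=> /Drho xr; apply: (le_trans r6); rewrite ler_pM2l//.
  exact: dist_boundary_ge xr.
(* Halfway between the spheres of radii 2r and 3r, so that the ball of radius [r / 2] around [z]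
   lies in B(x0, 3r) and outside B(x0, 2r). *)
pose z : 'rV[R]_n := x0 + (5 / 2 * r) *: delta_mx 0 (Ordinal n0).
have zE : enorm (z - x0) = 5 / 2 * r.
  by rewrite /z addrC addKr enormZ_delta// mulr_ge0 ?(ltW r0)// divr_ge0.
have B2D : eball z (r / 2) `<=` eball x0 (3 * r).
  move=> x zx; apply: le_lt_trans (ler_enormB z _ _) _.
  by rewrite enormC zE; move: zx; rewrite /eball /=; lra.
have B2out x : eball z (r / 2) x -> ~ eball x0 (2 * r) x.
  rewrite /eball /= => zx x2; have := ler_enormB x z x0.
  by rewrite zE (enormC x x0); lra.
have B1O : eball x0 r `<=` Omega.
  by move=> x x1; apply: DO; apply: lt_trans x1 _; lra.
have [K1 K10 maz1] := mazya_truncation n0 oO fin p1 pq (cap _ _ r0 B1O).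
have r20 : 0 < r / 2 by rewrite divr_gt0.
have [K2 K20 maz2] := mazya_truncation n0 oO fin p1 pq
  (cap _ _ r20 (subset_trans B2D DO)).
have [K K0 cutK] := @cutoff_energy_le R n n0 delta tau p r Omega x0 oO fin hdelta p1 r0.
pose phi := radial_cutoff x0 r.
pose psi x := 1 - phi x.
have cphi : cutoff r phi by exact: cutoff_radial.
have cpsi : cutoff r psi.
  move=> x y; have -> : psi x - psi y = phi y - phi x by rewrite /psi; ring.
  by rewrite distrC; exact: cphi.
have phi_le1 x : `|phi x| <= 1.
  by have /andP[h1 h2] := radial_cutoff_itv x0 r x; rewrite ger0_norm.
have psi_le1 x : `|psi x| <= 1.
  have /andP[h1 h2] := radial_cutoff_itv x0 r x.
  by rewrite /psi /phi ler_norml; apply/andP; split; lra.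
have phi_out x y : ~ eball x0 (2 * r) x -> ~ eball x0 (2 * r) y -> phi x = phi y.
  by move=> hx hy; rewrite /phi !radial_cutoff_out.
have psi_out x y : ~ eball x0 (2 * r) x -> ~ eball x0 (2 * r) y -> psi x = psi y.
  by move=> hx hy; rewrite /psi (phi_out x y).
(* For [e] above the energy of [u], [M * e] bounds the oscillation about [c] on B(x0, 3r) and
   [L * e] the energies of both products. [K3] comes from adding the two products, [K4] from passing
   from [c] to the mean. *)
pose b := fine (lebn (eball x0 (3 * r))).
pose M := (6 * r) `^ (n%:R + p * delta) / b.
have b0 : 0 <= b by rewrite fine_ge0// lebesgue_outer_ge0.
have M0 : 0 <= M by rewrite divr_ge0 ?powR_ge0.
pose L := K * (1 + M).
have L0 : 0 < L by rewrite mulr_gt0// ltr_wpDr.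
pose K3 := 2 `^ q * ((K1 + K2) * L `^ (q / p)).
have K30 : 0 < K3 by rewrite !mulr_gt0 ?powR_gt0 ?addr_gt0.
pose K4 := 2 `^ q * (1 + 2 `^ q) * K3.
have K40 : 0 < K4 by rewrite !mulr_gt0 ?powR_gt0// addr_gt0// powR_gt0.
exists (K4 * 2 `^ (q / p)); first by rewrite mulr_gt0// powR_gt0.
move=> u uc; set E := (\int[lebn]_(x in Omega) gfun delta tau Omega p u x)%E.
have E0 : (0 <= E)%E by exact: energy_ge0.
apply: lee_powR_right => // e Ee.
have e0 : 0 < e by rewrite -lte_fin (le_lt_trans E0).
have [y Dy Iy] := @exists_good_value R n n0 delta tau p r Omega x0 oO fin hdelta p1 r0 DO u e tau0 Dtau Ee.
set c := u y in Iy *.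
have ucc : Cont Omega (fun x => u x - c) by exact: ContB_cst.
have I0 : 0 <= M * e by rewrite mulr_ge0// ltW.
have mchi chi : cutoff r chi -> Cont Omega (fun x => chi x * (u x - c)).
  by move=> cchi; apply: (ContM oO) => //; exact/(continuous_Cont oO)/(cutoff_continuous cchi).
have part (K' : R) (B : set 'rV[R]_n) (chi : 'rV[R]_n -> R) : 0 < K' ->
    (forall v, Cont Omega v -> (forall x, B x -> v x = 0) ->
      (\int[lebn]_(x in Omega) (`|v x| `^ q)%:E <= K'%:E *
        (\int[lebn]_(x in Omega) gfun delta tau Omega p v x) `^ (q / p))%E) ->
    cutoff r chi -> (forall x, `|chi x| <= 1) ->
    (forall x y, ~ eball x0 (2 * r) x -> ~ eball x0 (2 * r) y -> chi x = chi y) ->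
    (forall x, B x -> chi x = 0) ->
    (\int[lebn]_(x in Omega) (`|chi x * (u x - c)| `^ q)%:E <=
      (K' * (L `^ (q / p) * e `^ (q / p)))%R%:E)%E.
  move=> K'0 maz cchi chi1 chi_out chiB.
  apply: (le_trans (maz (fun x => chi x * (u x - c)) _ _)).
  - exact: mchi.
  - by move=> x Bx; rewrite chiB// mul0r.
  rewrite EFinM; apply: lee_wpmul2l; first by rewrite lee_fin ltW.
  rewrite -powRM ?(ltW L0) ?(ltW e0)// -poweR_EFin.
  apply: ge0_le_poweR; [exact: ltW|exact: energy_ge0|].
  apply: (le_trans (cutK chi cchi chi1 chi_out u c (M * e) uc I0 Iy)).
  rewrite /L -mulrA [leRHS]EFinM; apply: lee_wpmul2l; first by rewrite lee_fin ltW.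
  by rewrite mulrDl mul1r EFinD leeD2r// ltW.
have h1 := part K1 (eball x0 r) phi K10 maz1 cphi phi_le1 phi_out
  (@radial_cutoff_in R n x0 r r0).
have psiB x : eball z (r / 2) x -> psi x = 0.
  by move=> /B2out hx; rewrite /psi /phi radial_cutoff_out// subrr.
have h2 := part K2 (eball z (r / 2)) psi K20 maz2 cpsi psi_le1 psi_out psiB.
have X0 : 0 < K3 * e `^ (q / p) by rewrite mulr_gt0// powR_gt0.
(* As [phi + psi = 1], the function [u - c] is the sum of the two products already estimated. *)
have main : (\int[lebn]_(x in Omega) (`|u x - c| `^ q)%:E <=
    (K3 * e `^ (q / p))%R%:E)%E.
  pose F (x : Rn R n) : \bar R := (`|phi x * (u x - c)| `^ q)%:E.
  pose G (x : Rn R n) : \bar R := (`|psi x * (u x - c)| `^ q)%:E.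
  have F0 x : Omega x -> (0 <= F x)%E by rewrite lee_fin powR_ge0.
  have G0 x : Omega x -> (0 <= G x)%E by rewrite lee_fin powR_ge0.
  have mF : measurable_fun (Omega : set (Rn R n)) F.
    by apply/measurable_EFinP; exact: (Cont_measurable_powR n0 oO q (mchi _ _)).
  have mG : measurable_fun (Omega : set (Rn R n)) G.
    by apply/measurable_EFinP; exact: (Cont_measurable_powR n0 oO q (mchi _ _)).
  have t0 : 0 < 2 `^ q :> R by rewrite powR_gt0.
  apply: (@le_trans _ _ (\int[lebn]_(x in Omega) ((2 `^ q)%R%:E * (F x + G x)))%E).
    apply: ge0_le_lower_integral => x _; first by rewrite lee_fin powR_ge0.
    rewrite -EFinD -EFinM lee_fin.
    apply: le_trans (ler_powRD_convex _ _ _) => //; last exact: ltW.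
    apply: ler_powR_base; rewrite ?(ltW q0)//.
    apply: le_trans (ler_normD _ _).
    have pE : phi x + psi x = 1 by rewrite /psi addrC subrK.
    by rewrite -mulrDl pE mul1r.
  apply: (le_trans (ge0_lower_integralZl_le lebn t0 _)).
    by move=> x Ox; rewrite adde_ge0 ?F0 ?G0.
  rewrite /K3 -mulrA [leRHS]EFinM; apply: lee_wpmul2l; first by rewrite lee_fin ltW.
  rewrite (ge0_integralD lebn mO F0 mF G0 mG).
  by rewrite -mulrA mulrDl EFinD leeD.
have O0 : (0 < lebn Omega)%E.
  exact: lt_le_trans (lebn_eball_gt0 n0 x0 r0) (le_lebesgue_outer B1O).
apply: (le_trans (mean_oscillation_le n0 oO fin q1 uc O0 X0 main)).
by rewrite /K4 mulrA.
Qed.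

End sobolev_of_capacity.

Theorem theorem0p1 (R : realType) (n : nat) (hn : (2 <= n)%N)
    (Omega : set 'rV[R]_n) (hOmega : domain Omega)
    (hfin : (lebn Omega < +oo)%E)
    (delta : R) (hdelta : 0 < delta < 1) (tau : R) (htau : 0 < tau)
    (p q : R) (hp : 1 <= p) (hpq : p <= q) :
  fractional_sobolev_poincare delta tau Omega q p <->
  (forall (c : 'rV[R]_n) (r : R), 0 < r -> eball c r `<=` Omega ->
     capacity_condition delta tau Omega q p (eball c r)).
Proof.
have n0 : (0 < n)%N by exact: ltnW.
have p0 : 0 < p by exact: lt_le_trans hp.
have q0 : 0 < q by exact: lt_le_trans hpq.
split; last exact: capacity_sobolev.
move=> sob c r r0 BO; have [oO _ _] := hOmega.
exact: sobolev_capacity.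
Qed.
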